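(* Let $\mathbb G=V_1\times V_2$ be a step-two Carnot group of rank $r$. (a) Let $f\in\mathcal A_h(\mathbb G)$. Then for every $(x,z)\in\mathbb G$ the map $t\in(0,+\infty)\mapsto(f\circ\delta_t)(x,z)$ is a polynomial of degree $\leq r$; denote its coefficients by $f_j(x,z):=\frac{1}{j!}\frac{d^j}{dt^j}(f\circ\delta_t)(x,z)\big|_{t=0}$. (b) Let $n\geq r$ be an integer and $\pi:\mathbb F_n\to\mathbb G$ a surjective Carnot morphism. For each $k\in\{0,\dots,n\}$ and each $\eta\in\Lambda^k(\pi)$ there is a unique map $\psi_\eta:\mathbb G\to\Lambda^n(\mathbb R^n)\cong\mathbb R$ with $\widetilde\psi_\eta=\psi_\eta\circ\pi$ on $\mathbb F_n$. Moreover $\mathcal A_h(\mathbb G)$ and $\oplus_{k=n-r}^n\Lambda^k(\pi)$ are isomorphic as real vector spaces: a map $f:\mathbb G\to\mathbb R$ belongs to $\mathcal A_h(\mathbb G)$ if and only if there is $(\eta_{n-r},\dots,\eta_n)\in\oplus_{k=n-r}^n\Lambda^k(\pi)$ (with $\eta_k\in\Lambda^k(\pi)$) such that $f=\sum_{k=n-r}^n\psi_{\eta_k}$. Furthermore such $(\eta_{n-r},\dots,\eta_n)$ is unique and $\psi_{\eta_k}=f_{n-k}$ for all $k\in\{n-r,\dots,n\}$.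
   Context: A step-two Carnot group is $\mathbb G=V_1\times V_2$, where $V_1,V_2$ are finite-dimensional real vector spaces with $V_2\neq\{0\}$, equipped with a bilinear skew-symmetric map $[\cdot,\cdot]:V_1\times V_1\to V_2$ with $\operatorname{span}\{[x,x']:x,x'\in V_1\}=V_2$, and group law $(x,z)\cdot(x',z')=(x+x',z+z'+[x,x'])$. Its rank is $\dim V_1$. Dilations: $\delta_t(x,z)=(tx,t^2z)$ for $t>0$. A map $f:\mathbb G\to\mathbb R$ is $h$-affine, $f\in\mathcal A_h(\mathbb G)$, if for all $(x,z)\in\mathbb G$, $y\in V_1$, the map $t\in\mathbb R\mapsto f((x,z)\cdot(ty,0))$ is affine. The free step-two Carnot group of rank $n$ is $\mathbb F_n=\Lambda^1(\mathbb R^n)\times\Lambda^2(\mathbb R^n)$ ($\Lambda^k(\mathbb R^n)$ = alternating $k$-forms on $\mathbb R^n$) with bracket $[\theta,\theta']=\theta\wedge\theta'$. A Carnot morphism $\pi:\mathbb G\to\mathbb G'$ between step-two Carnot groups is a map $\pi(x,z)=(\pi_1(x),\pi_2(z))$ with $\pi_1:V_1\to V_1'$, $\pi_2:V_2\to V_2'$ linear and $\pi_2([x,y])=[\pi_1(x),\pi_1(y)]'$. For $\eta\in\Lambda^k(\mathbb R^n)$, $\operatorname{Anh}^{1,2}_\wedge\eta:=\{(\theta,\omega)\in\mathbb F_n:\theta\wedge\eta=0,\ \omega\wedge\eta=0\}$, and $\Lambda^k(\pi):=\{\eta\in\Lambda^k(\mathbb R^n):\ker\pi\subset\operatorname{Anh}^{1,2}_\wedge\eta\}$.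 For $m\in\{0,\dots,n\}$ and $\eta\in\Lambda^{n-m}(\mathbb R^n)$, $\widetilde\psi_\eta:\mathbb F_n\to\Lambda^n(\mathbb R^n)$ is defined by $\widetilde\psi_\eta(\theta,\omega)=\omega^{m/2}\wedge\eta$ if $m$ is even and $\widetilde\psi_\eta(\theta,\omega)=\theta\wedge\omega^{(m-1)/2}\wedge\eta$ if $m$ is odd ($\omega^j$ is the $j$-th exterior power, $\omega^0=1$). $\Lambda^n(\mathbb R^n)$-valued maps are identified with real-valued maps via the basis $dx_1\wedge\cdots\wedge dx_n$. *)

(* Defs.v *)
From HB Require Import structures.
From mathcomp Require Import all_boot all_order all_algebra.
From mathcomp Require Import boolp reals normedtype derive.
Set Implicit Arguments. Unset Strict Implicit. Unset Printing Implicit Defensive.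
Import Order.TTheory GRing.Theory Num.Theory.
Local Open Scope ring_scope.

Section Carnot.
Variables (R : realType) (V1 V2 : vectType R) (br : V1 -> V1 -> V2).

Definition cmul (p q : V1 * V2) : V1 * V2 :=
  (p.1 + q.1, p.2 + q.2 + br p.1 q.1).

Definition dil (t : R) (p : V1 * V2) : V1 * V2 := (t *: p.1, t ^+ 2 *: p.2).

Definition h_affine (f : V1 * V2 -> R) : Prop :=
  forall (p : V1 * V2) (y : V1), exists a b : R,
    forall t : R, f (cmul p (t *: y, 0)) = a + b * t.

Definition fcoef (f : V1 * V2 -> R) (j : nat) (p : V1 * V2) : R :=
  @derive1n R R^o j (fun t : R => (f (dil t p) : R^o)) 0 / (j`!)%:R.
End Carnot.

(* An element of Lambda(R^n) is given by its coefficients on the basis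
   dx_I = dx_{i1} /\ ... /\ dx_{ik}, I = {i1 < ... < ik} a subset of 'I_n. *)
Notation Lam n R := {ffun {set 'I_n} -> R^o}.

Section Ext.
Variables (n : nat) (R : realType).

Definition homog (k : nat) (a : Lam n R) : Prop :=
  forall S : {set 'I_n}, #|S| != k -> a S = 0.

(* sign of dx_A /\ dx_B = sgn A B dx_(A u B) for disjoint A B *)
Definition wsgn (A B : {set 'I_n}) : R :=
  (-1) ^+ #|[set p : 'I_n * 'I_n | [&& p.1 \in A, p.2 \in B & (p.2 < p.1)%N]]|.

Definition wedge (a b : Lam n R) : Lam n R :=
  [ffun S : {set 'I_n} =>
     \sum_(A : {set 'I_n} | A \subset S) wsgn A (S :\: A) * a A * b (S :\: A)].

Definition wone : Lam n R := [ffun S : {set 'I_n} => (S == set0)%:R].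

Definition wpow (w : Lam n R) (j : nat) : Lam n R := iter j (wedge w) wone.

(* identification Lambda^n(R^n) ~ R via dx_1 /\ ... /\ dx_n *)
Definition topcoef (a : Lam n R) : R := a setT.

Definition inFn (th om : Lam n R) : Prop := homog 1 th /\ homog 2 om.

Definition psit (k : nat) (eta th om : Lam n R) : R :=
  let m := (n - k)%N in
  if ~~ odd m then topcoef (wedge (wpow om m./2) eta)
  else topcoef (wedge th (wedge (wpow om m./2) eta)).

Variables (V1 V2 : vectType R) (br : V1 -> V1 -> V2).
Variables (pi1 : Lam n R -> V1) (pi2 : Lam n R -> V2).

Definition carnot_morphism : Prop :=
  (forall (a : R) th th', homog 1 th -> homog 1 th' ->
     pi1 (a *: th + th') = a *: pi1 th + pi1 th') /\
  (forall (a : R) om om', homog 2 om -> homog 2 om' ->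
     pi2 (a *: om + om') = a *: pi2 om + pi2 om') /\
  (forall th th', homog 1 th -> homog 1 th' ->
     pi2 (wedge th th') = br (pi1 th) (pi1 th')).

Definition carnot_surj : Prop :=
  forall g : V1 * V2, exists th om, inFn th om /\ (pi1 th, pi2 om) = g.

Definition anh (eta th om : Lam n R) : Prop :=
  wedge th eta = 0 /\ wedge om eta = 0.

Definition LamPi (k : nat) (eta : Lam n R) : Prop :=
  homog k eta /\
  forall th om, inFn th om -> pi1 th = 0 -> pi2 om = 0 -> anh eta th om.

(* psi_eta : G -> R, defined through a (chosen) preimage under pi;
   the theorem asserts it is the unique psi with tilde psi_eta = psi o pi. *)
Definition psi (k : nat) (eta : Lam n R) (g : V1 * V2) : R :=
  match pselect (exists p : Lam n R * Lam n R, inFn p.1 p.2 /\ (pi1 p.1, pi2 p.2) = g) with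
  | left H => let p := projT1 (cid H) in psit k eta p.1 p.2
  | right _ => 0
  end.
End Ext.

(* Main.v *)
(** On the Heisenberg group, two skew lines conjugate under the contact form are
    joined pointwise by horizontal lines, and comparing the values of an
    [h]-affine function on such pairs forces it to be affine.  Applied to the
    subgroups generated by two horizontal vectors, this turns [h]-affinity on a
    step-two group, without any regularity assumption, into three identities
    ([split_affine]).  These are stable under contraction with a horizontal
    vector [e], and [contract_expansion] recovers [f] on the subgroup generated
    by [e] and a subspace [W] from [f] and its contraction on that of [W].
    Induction on generators gives both the degree bound in (a) and the fact
    that [f] is determined by its values at the [2 ^ n] points attached to the
    sublists of [n] generators.

    On the free group the functions attached to forms are [h]-affine and form a
    [2 ^ n]-dimensional space, so evaluation at these points is bijective on it
    and every [h]-affine function comes from a form.  On a quotient [G], the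
    pull-back of [f] comes from a form, and polarizing its invariance under
    [ker pi] shows that the homogeneous parts of this form lie in [LamPi]; the
    components of degree [> r] vanish by (a). *)
Require Import Defs.
From HB Require Import structures.
From mathcomp Require Import all_boot all_order all_algebra.
From mathcomp Require Import boolp reals normedtype derive.
From mathcomp Require Import ring lra zify.
Import Order.TTheory GRing.Theory Num.Theory.
Local Open Scope ring_scope.

Set Implicit Arguments.
Unset Strict Implicit.
Unset Printing Implicit Defensive.

(** * The Heisenberg group *)

Section Heisenberg.
Variables (R : realFieldType) (h : R -> R -> R -> R).
Hypothesis h_lines : forall s t u a b, exists A B, forall tau,
  h (s + tau * a) (t + tau * b) (u + tau * (t * a - s * b)) = A + B * tau.

Lemma heisenberg_chord (s t u s' t' u' k : R) : u' - u = t * s' - s * t' ->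
  h (s + k * (s' - s)) (t + k * (t' - t)) (u + k * (u' - u)) =
  (1 - k) * h s t u + k * h s' t' u'.
Proof.
move=> E; have [A [B AB]] := h_lines s t u (s' - s) (t' - t).
have E' : t * (s' - s) - s * (t' - t) = u' - u by rewrite E; ring.
rewrite E' in AB; rewrite AB.
have := AB 0; rewrite !mul0r !addr0 => ->.
have := AB 1; rewrite !mul1r !(addrC _ (_ - _)) !subrK => ->.
by ring.
Qed.

(** Homogenizations of [h] on the skew lines of points [(1, x, x)] and [(-1, y, - y)]: any point of
    one is joined to any point of the other by a horizontal line. *)
Let P a b := a * h 1 (b / a) (b / a).
Let Q c d := c * h (- 1) (d / c) (- (d / c)).

Local Lemma homog_split (a b c d : R) : 0 < a -> 0 < c ->
  (a + c) * h ((a - c) / (a + c)) ((b + d) / (a + c)) ((b - d) / (a + c)) =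
  P a b + Q c d.
Proof.
move=> a0 c0; have ac0 : 0 < a + c by lra.
have := @heisenberg_chord 1 (b / a) (b / a) (- 1) (d / c) (- (d / c)) (c / (a + c)).
have -> : 1 + c / (a + c) * (- 1 - 1) = (a - c) / (a + c) by field; lra.
have -> : b / a + c / (a + c) * (d / c - b / a) = (b + d) / (a + c).
  by field; rewrite !gt_eqF.
have -> : b / a + c / (a + c) * (- (d / c) - b / a) = (b - d) / (a + c).
  by field; rewrite !gt_eqF.
move=> ->; last by ring.
by rewrite /P /Q; field; rewrite !gt_eqF.
Qed.

(** The determinant condition says that the two chord points given by [homog_split] are themselves
    joined by a horizontal line; on it, the weights [a + c] and [a' + c'] single out the chord point
    of the summed data. *)
Local Lemma homog_add (a b c d a' b' c' d' : R) :
  0 < a -> 0 < c -> 0 < a' -> 0 < c' -> a * b' - a' * b = c * d' - c' * d ->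
  P (a + a') (b + b') + Q (c + c') (d + d') =
  P a b + Q c d + (P a' b' + Q c' d').
Proof.
move=> a0 c0 a'0 c'0 E; rewrite -!homog_split //; try lra.
have ac0 : a + c != 0 by rewrite gt_eqF //; lra.
have ac'0 : a' + c' != 0 by rewrite gt_eqF //; lra.
have aac0 : a + a' + (c + c') != 0 by rewrite gt_eqF //; lra.
have aac0' : a + c + a' + c' != 0 by rewrite gt_eqF //; lra.
have := @heisenberg_chord ((a - c) / (a + c)) ((b + d) / (a + c)) ((b - d) / (a + c))
  ((a' - c') / (a' + c')) ((b' + d') / (a' + c')) ((b' - d') / (a' + c'))
  ((a' + c') / (a + a' + (c + c'))).
have step x x' : x / (a + c) + (a' + c') / (a + a' + (c + c')) *
    (x' / (a' + c') - x / (a + c)) = (x + x') / (a + a' + (c + c')).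
  by field; do ?[apply/andP; split].
rewrite !step.
have -> : a + a' - (c + c') = a - c + (a' - c') by ring.
have -> : b + b' + (d + d') = b + d + (b' + d') by ring.
have -> : b + b' - (d + d') = b - d + (b' - d') by ring.
move=> ->; first by field; do ?[apply/andP; split].
have E2 : (b' - d') * (a + c) - (b - d) * (a' + c') =
   (b + d) * (a' - c') - (a - c) * (b' + d').
  by apply/eqP; rewrite -subr_eq0; apply/eqP; lra.
transitivity (((b' - d') * (a + c) - (b - d) * (a' + c')) / ((a + c) * (a' + c'))).
  by field; do ?[apply/andP; split].
by rewrite E2; field; do ?[apply/andP; split].
Qed.

(* The defects of additivity of [P] and [Q] are opposite and depend only on the
   determinant of their two arguments; let [F] be the defect of [P].  It is even,
   and the cocycle identity at [(v, w, v + w)] gives [F (2 D) = 0]. *)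
Local Lemma P_add (a b a' b' : R) : 0 < a -> 0 < a' ->
  P (a + a') (b + b') = P a b + P a' b'.
Proof.
pose F D := Q 1 0 + Q 1 D - Q 2 D.
have defect x y x' y' : 0 < x -> 0 < x' ->
    P (x + x') (y + y') = P x y + P x' y' + F (x * y' - x' * y).
  move=> x0 x'0.
  have := @homog_add x y 1 0 x' y' 1 (x * y' - x' * y) x0 ltr01 x'0 ltr01.
  by rewrite /F add0r -[1 + 1]/(2 : R) => H; have {}H := H ltac:(ring); lra.
have FN D : F (- D) = F D.
  have d1 := @defect 1 0 1 D ltr01 ltr01.
  have d2 := @defect 1 D 1 0 ltr01 ltr01.
  rewrite (_ : 1 * D - 1 * 0 = D) in d1; last by ring.
  rewrite (_ : 1 * 0 - 1 * D = - D) in d2; last by ring.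
  rewrite (addrC D 0) in d2; lra.
have F0 : F 0 = 0.
  have := @defect 1 0 1 0 ltr01 ltr01; rewrite addr0 mulr0 subrr /P !mul0r.
  by lra.
have F2 D : F (2 * D) = 0.
  have two0 : 0 < 1 + 1 :> R by lra.
  have d1 := @defect 1 0 1 D ltr01 ltr01.
  have d2 := @defect (1 + 1) (0 + D) (1 + 1) (0 + D) two0 two0.
  have d3 := @defect 1 D (1 + 1) (0 + D) ltr01 two0.
  have d4 := @defect 1 0 (1 + (1 + 1)) (D + (0 + D)) ltr01 ltac:(lra).
  have e : 1 + 1 + (1 + 1) = 1 + (1 + (1 + 1)) :> R by ring.
  have e' : 0 + D + (0 + D) = 0 + (D + (0 + D)) by ring.
  rewrite e e' in d2.
  have e1 : 1 * D - 1 * 0 = D by ring.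
  have e2 : (1 + 1) * (0 + D) - (1 + 1) * (0 + D) = 0 by ring.
  have e3 : 1 * (0 + D) - (1 + 1) * D = - D by ring.
  have e4 : 1 * (D + (0 + D)) - (1 + (1 + 1)) * 0 = 2 * D by ring.
  rewrite e1 in d1; rewrite e2 F0 in d2; rewrite e3 FN in d3; rewrite e4 in d4.
  by lra.
move=> a0 a'0; rewrite defect //.
have -> : a * b' - a' * b = 2 * ((a * b' - a' * b) / 2) by field.
by rewrite F2 addr0.
Qed.

Local Lemma Q_add (c d c' d' : R) : 0 < c -> 0 < c' ->
  Q (c + c') (d + d') = Q c d + Q c' d'.
Proof.
move=> c0 c'0.
(* The pairs [(1, 0)] and [(1, D)] have determinant [D], taken here to be that of the arguments of
   [Q]; since [P] has no defect, neither has [Q]. *)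
have := @homog_add 1 0 c d 1 (c * d' - c' * d) c' d' ltr01 c0 ltr01 c'0.
rewrite P_add ?ltr01 // => H; have {}H := H ltac:(ring); lra.
Qed.
End Heisenberg.

(** The hypothesis is equality in Jensen's inequality with arbitrary positive real weights: it
    controls every positive scaling about 0 and the reflection [x] to [- x], not merely
    additivity. *)
Lemma perspective_affine (R : realFieldType) (phi : R -> R) :
  (forall a b a' b', 0 < a -> 0 < a' ->
    (a + a') * phi ((b + b') / (a + a')) = a * phi (b / a) + a' * phi (b' / a')) ->
  forall a b, 0 < a -> a * phi (b / a) = a * phi 0 + b * (phi 1 - phi 0).
Proof.
move=> phi_add.
have contr l x : 0 < l -> l < 1 -> phi (l * x) = (1 - l) * phi 0 + l * phi x.
  move=> l0 l1; have := @phi_add (1 - l) 0 l (l * x) ltac:(lra) l0.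
  rewrite subrK divr1 mul1r add0r mul0r => ->.
  by congr (_ + _ * phi _); field; rewrite gt_eqF.
have scal l x : 0 < l -> phi (l * x) = (1 - l) * phi 0 + l * phi x.
  move=> l0; case: (ltrgtP l 1) => [l1|l1|->]; first exact: contr.
    have li : 0 < l^-1 by rewrite invr_gt0.
    have := @contr l^-1 (l * x) li; rewrite invf_lt1 // => /(_ l1).
    rewrite mulKf ?gt_eqF // => ->.
    by field; rewrite gt_eqF.
  by rewrite !mul1r subrr mul0r add0r.
have opp x : phi (- x) = 2 * phi 0 - phi x.
  have := @phi_add 1 x 1 (- x) ltr01 ltr01.
  by rewrite subrr mul0r !divr1 !mul1r; lra.
have aff x : phi x = phi 0 + x * (phi 1 - phi 0).
  case: (ltrgtP x 0) => [x0|x0|->]; last by rewrite mul0r addr0.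
    have := @scal (- x) 1 ltac:(lra); rewrite mulr1 opp; lra.
  by have := @scal x 1 x0; rewrite mulr1; lra.
by move=> a b a0; rewrite aff; field; rewrite gt_eqF.
Qed.

Lemma heisenberg_affine (R : realFieldType) (h : R -> R -> R -> R) :
  (forall s t u a b, exists A B, forall tau,
    h (s + tau * a) (t + tau * b) (u + tau * (t * a - s * b)) = A + B * tau) ->
  exists A B C D, forall s t u, h s t u = D + A * s + B * t + C * u.
Proof.
move=> hl.
have Pa := @perspective_affine _ (fun x => h 1 x x) (fun a b a' b' => @P_add _ h hl a b a' b').
have Qa := @perspective_affine _ (fun x => h (- 1) x (- x))
   (fun a b a' b' => @Q_add _ h hl a b a' b').
set p0 := h 1 0 0 in Pa; set p1 := h 1 1 1 - p0 in Pa.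
rewrite oppr0 in Qa; set q0 := h (-1) 0 0 in Qa; set q1 := h (-1) 1 (-1) - q0 in Qa.
(* Inside the slab every point lies on a chord between the two skew lines, with weights
   [(1 + s) / 2] and [(1 - s) / 2]. *)
have slab s t u : -1 < s -> s < 1 -> h s t u =
    (1 + s) / 2 * p0 + (t + u) / 2 * p1 + ((1 - s) / 2 * q0 + (t - u) / 2 * q1).
  move=> s0 s1.
  rewrite -Pa; last lra; rewrite -Qa; last lra.
  have := @homog_split _ h hl ((1 + s) / 2) ((t + u) / 2) ((1 - s) / 2) ((t - u) / 2).
  have -> : (1 + s) / 2 + (1 - s) / 2 = 1 by lra.
  rewrite !divr1 mul1r.
  have -> : (1 + s) / 2 - (1 - s) / 2 = s by lra.
  have -> : (t + u) / 2 + (t - u) / 2 = t by lra.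
  have -> : (t + u) / 2 - (t - u) / 2 = u by lra.
  by move=> ->; lra.
exists ((p0 - q0) / 2), ((p1 + q1) / 2), ((p1 - q1) / 2), ((p0 + q0) / 2) => s t u.
(* The horizontal line in direction [(1, 0)] meets the slab at first coordinates 0 and 1/2; the two
   values there fix the affine function along it. *)
have [A [B AB]] := hl s t u 1 0.
have l0 := AB 0; have l1 := AB (- s); have l2 := AB (1 / 2 - s).
rewrite ?mulr0 ?mulr1 ?mul0r ?addr0 ?subr0 in l0 l1 l2.
have slab1 := slab (s - s) t (u + - s * t) ltac:(lra) ltac:(lra).
have slab2 := slab (s + (1 / 2 - s)) t (u + (1 / 2 - s) * t) ltac:(lra) ltac:(lra).
rewrite slab1 in l1; rewrite slab2 in l2; rewrite l0.
have BE : B = (p0 - q0) / 2 + t * (p1 - q1) / 2 by lra.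
by rewrite BE in l1; lra.
Qed.

(** * H-affine functions on a step-two group *)

Section StepTwo.
Import VectorInternalTheory.

(* [ring] does not decide equations in modules: go through coordinates. *)
Ltac module_ring :=
  apply: v2r_inj; apply/rowP => ?;
  do ?[rewrite linearD | rewrite linearN | rewrite linearZ | rewrite linear0];
  rewrite ?mxE /=; ring.

Variables (R : realType) (V1 V2 : vectType R) (br : V1 -> V1 -> V2).
Hypothesis br_linl :
  forall (a : R) (x y w : V1), br (a *: x + y) w = a *: br x w + br y w.
Hypothesis br_skew : forall x y : V1, br x y = - br y x.

Lemma brDl x y w : br (x + y) w = br x w + br y w.
Proof. by have := br_linl 1 x y w; rewrite !scale1r. Qed.

Lemma br0l w : br 0 w = 0.
Proof. by apply: (@addrI _ (br 0 w)); rewrite -brDl !addr0. Qed.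

Lemma brZl a x w : br (a *: x) w = a *: br x w.
Proof. by have := br_linl a x 0 w; rewrite br0l !addr0. Qed.

Lemma brNl x w : br (- x) w = - br x w.
Proof. by rewrite -scaleN1r brZl scaleN1r. Qed.

Lemma brDr x y w : br w (x + y) = br w x + br w y.
Proof. by rewrite br_skew brDl opprD -!(br_skew w). Qed.

Lemma brZr a x w : br w (a *: x) = a *: br w x.
Proof. by rewrite br_skew brZl -scalerN -br_skew. Qed.

Lemma br0r w : br w 0 = 0.
Proof. by rewrite br_skew br0l oppr0. Qed.

Lemma brxx x : br x x = 0.
Proof.
have /eqP := br_skew x x; rewrite -addr_eq0 -mulr2n -scaler_nat scaler_eq0.
by rewrite pnatr_eq0 => /eqP.
Qed.

Definition brE := (brDl, brDr, brZl, brZr, brNl, br0l, br0r, brxx).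

Implicit Types f : V1 * V2 -> R.

Definition horizontal_affine f := forall (x y : V1) (z : V2) (s t : R),
  f (s *: x + t *: y, z) =
  f (0, z) + s * (f (x, z) - f (0, z)) + t * (f (y, z) - f (0, z)).

Definition vertical_affine f := forall (x w y : V1) (z : V2) (u : R),
  f (x, z + u *: br w y) = f (x, z) + u * (f (x, z + br w y) - f (x, z)).

(** The counterpart for forms is the rule y /\ w /\ y = 0: there is no cross term between [y] and
    [br w y]. *)
Definition mixed_alternating f := forall (w y : V1) (z : V2),
  f (y, z + br w y) - f (y, z) = f (0, z + br w y) - f (0, z).

Definition split_affine f :=
  [/\ horizontal_affine f, vertical_affine f & mixed_alternating f].

(** [(s, t, u)] parametrizes the left translate by [(x, z)] of the subgroup generated by [y] and
    [w]; the order in [br w y] matches the sign convention of [heisenberg_affine]. *)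
Lemma h_affine_heisenberg f : h_affine br f -> forall (x w y : V1) (z : V2),
  exists A B C D : R, forall s t u : R,
    f (x + (s *: y + t *: w), z + u *: br w y + br x (s *: y + t *: w)) =
    D + A * s + B * t + C * u.
Proof.
move=> fA x w y z.
apply: (@heisenberg_affine _ (fun s t u =>
  f (x + (s *: y + t *: w), z + u *: br w y + br x (s *: y + t *: w)))).
move=> s t u a b.
have [A [B AB]] := fA (x + (s *: y + t *: w),
  z + u *: br w y + br x (s *: y + t *: w)) (a *: y + b *: w).
exists A, B => tau; rewrite -AB /cmul /=; congr (f (_, _)); first by module_ring.
rewrite !brE (br_skew y w); move: (br w y) (br x y) (br x w) => p q r.
by module_ring.
Qed.

Lemma h_affine_split f : h_affine br f -> split_affine f.
Proof.
move=> fA; have fH := h_affine_heisenberg fA; split.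
- move=> x y z s t; have [A [B [C [D H]]]] := fH 0 y x z.
  have e s' t' : f (s' *: x + t' *: y, z) = D + A * s' + B * t'.
    by have := H s' t' 0; rewrite br0l scale0r !addr0 add0r mulr0 addr0.
  have := e 0 0; have := e 1 0; have := e 0 1.
  rewrite !scale1r !scale0r !add0r !addr0 !mulr0 !mulr1 !addr0 e => -> -> ->.
  by ring.
- move=> x w y z u; have [A [B [C [D H]]]] := fH x w y z.
  have e u' : f (x, z + u' *: br w y) = D + C * u'.
    by have := H 0 0 u'; rewrite !scale0r !addr0 !mulr0 br0r !addr0.
  have e0 := e 0; have e1 := e 1.
  by rewrite scale0r addr0 in e0; rewrite scale1r in e1; rewrite e e0 e1; ring.
- move=> w y z; have [A [B [C [D H]]]] := fH 0 w y z.
  have e s u : f (s *: y, z + u *: br w y) = D + A * s + C * u.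
    by have := H s 0 u; rewrite br0l scale0r !addr0 add0r mulr0 addr0.
  have := e 0 0; have := e 0 1; have := e 1 0; have := e 1 1.
  rewrite !scale1r !scale0r !addr0 => -> -> -> ->; ring.
Qed.

(** The segment from [z + br (2 w) y] to [z + br (2 w') y] runs along the single bracket
    [br (w' - w) y], so [f] is affine on it; its midpoint is [z + br (w + w') y]. *)
Lemma vertical_additive f : vertical_affine f -> forall (x w w' y : V1) (z : V2),
  f (x, z + br (w + w') y) = f (x, z + br w y) + f (x, z + br w' y) - f (x, z).
Proof.
move=> fV x w w' y z.
have d v : f (x, z + br (2%:R *: v) y) = 2 * f (x, z + br v y) - f (x, z).
  by rewrite brZl fV; ring.
have := fV x (w' - w) y (z + br (2%:R *: w) y) 2%:R.
have -> : z + br (2%:R *: w) y + 2%:R *: br (w' - w) y = z + br (2%:R *: w') y.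
  by rewrite !brE; module_ring.
have -> : z + br (2%:R *: w) y + br (w' - w) y = z + br (w + w') y.
  by rewrite !brE; module_ring.
by rewrite !d; lra.
Qed.

Lemma vertical_scale f : vertical_affine f -> forall (x w y : V1) (z : V2) (u : R),
  f (x, z + br (u *: w) y) = f (x, z) + u * (f (x, z + br w y) - f (x, z)).
Proof. by move=> fV x w y z u; rewrite brZl fV. Qed.

(* The contraction of [f] with [e]: if [f] is given by a form [eta], this is
   the function given by [iota_e eta] on a complement of [e]. *)
Definition contract e f : V1 * V2 -> R := fun p =>
  f (e, p.2) - 2 * f (0, p.2) + f (0, p.2 + br p.1 e).

(** For the mixed identity the key point is that [br w y + br y e = br (w - e) y] is again a single
    bracket. *)
Lemma contract_split e f : split_affine f -> split_affine (contract e f).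
Proof.
move=> [fH fV fM]; have fA := vertical_additive fV; split; rewrite /contract.
- move=> x y z s t /=; rewrite br0l addr0 fA !vertical_scale //.
  by ring.
- move=> x w y z u /=; rewrite [z + u *: _ + _]addrAC [z + br w y + _]addrAC !fV.
  by ring.
- move=> w y z /=; rewrite br0l !addr0.
  have -> : z + br w y + br y e = z + br (w - e) y.
    by rewrite (br_skew y e) brDl brNl addrA.
  have -> : z + br y e = z + br (- e) y by rewrite (br_skew y e) brNl.
  by rewrite fA; ring.
Qed.

Lemma contract_expansion e f : split_affine f -> forall (x y : V1) (z : V2) (c : R),
  f (c *: e + x, z + br y e) =
  f (x, z) + contract e f (y, z) + c * contract e f (0, z)
  - contract e f (0, z + br y x).
Proof.
move=> [fH fV fM] x y z c; have fA := vertical_additive fV; rewrite /contract /=.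
have fH' u v w : f (u + v, w) = f (u, w) + f (v, w) - f (0, w).
  by have := fH u v w 1 1; rewrite !scale1r => ->; ring.
have := fH e x (z + br y e) c 1; rewrite scale1r => ->.
rewrite !br0l !addr0.
(* Polarizing the mixed identity at [x + e] replaces the cross term of [x] with [br y e] by minus
   that of [e] with [br y x], and the latter is a difference of two values of the contraction. *)
have M1 := fM y e z; have M2 := fM y x z; have M3 := fM y (x + e) z.
rewrite !brDr !fH' in M3.
have A1 : f (0, z + (br y x + br y e)) =
    f (0, z + br y x) + f (0, z + br y e) - f (0, z).
  have := fA 0 (- x) (- e) y z; rewrite brDl !brNl -!(br_skew y) => ->.
  by ring.
have A2 v : f (v, z + (br y x + br y e)) =
    f (v, z + br y x) + f (v, z + br y e) - f (v, z).
  have := fA v (- x) (- e) y z; rewrite brDl !brNl -!(br_skew y) => ->.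
  by ring.
rewrite !A2 in M3.
have -> : f (e, z + br y e) = f (e, z) + f (0, z + br y e) - f (0, z) by lra.
by lra.
Qed.

(** * Generators, test points and dilations *)

Fixpoint in_span (s : seq V1) (x : V1) : Prop :=
  if s is e :: s' then exists c x', in_span s' x' /\ x = c *: e + x' else x = 0.

(** The span of the brackets of [s], arranged so that each generator [e] adds a single bracket
    [br y e] with [y] in the span of the tail, as [contract_expansion] requires. *)
Fixpoint in_span2 (s : seq V1) (z : V2) : Prop :=
  if s is e :: s' then
    exists y z', [/\ in_span s' y, in_span2 s' z' & z = z' + br y e]
  else z = 0.

Lemma in_spanP s a x y : in_span s x -> in_span s y -> in_span s (a *: x + y).
Proof.
elim: s x y => [|e s IH] x y /= => [-> ->|]; first by rewrite scaler0 addr0.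
move=> [c [x' [sx ->]]] [d [y' [sy ->]]]; exists (a * c + d), (a *: x' + y').
by split; [exact: IH | module_ring].
Qed.

Lemma in_span0 s : in_span s 0.
Proof. by elim: s => //= e s IH; exists 0, 0; rewrite scale0r addr0. Qed.

Lemma in_spanZ s a x : in_span s x -> in_span s (a *: x).
Proof. by move=> sx; rewrite -[_ *: _]addr0; apply/in_spanP/in_span0. Qed.

Lemma in_span_mem s x : x \in s -> in_span s x.
Proof.
elim: s => //= e s IH; rewrite inE => /predU1P[->|/IH sx].
  by exists 1, 0; rewrite scale1r addr0; split=> //; exact: in_span0.
by exists 0, x; rewrite scale0r add0r.
Qed.

Lemma in_span2P s a z z' : in_span2 s z -> in_span2 s z' -> in_span2 s (a *: z + z').
Proof.
elim: s z z' => [|e s IH] z z' /= => [-> ->|]; first by rewrite scaler0 addr0.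
move=> [x [z1 [sx sz1 ->]]] [y [z2 [sy sz2 ->]]].
exists (a *: x + y), (a *: z1 + z2); split; [exact: in_spanP | exact: IH |].
by rewrite !brE; module_ring.
Qed.

Lemma in_span20 s : in_span2 s 0.
Proof.
elim: s => //= e s IH; exists 0, 0; rewrite br0l addr0.
by split=> //; exact: in_span0.
Qed.

Lemma in_span2_br s x y : in_span s x -> in_span s y -> in_span2 s (br x y).
Proof.
elim: s x y => [|e s IH] x y /= => [-> ->|]; first by rewrite br0l.
move=> [c [x' [sx ->]]] [d [y' [sy ->]]].
(* By skew-symmetry all terms containing [e] collect into one bracket with [e] on the right. *)
exists (d *: x' + - c *: y'), (br x' y'); split; last 1 first.
- by rewrite !brE (br_skew e); module_ring.
- by apply: in_spanP => //; exact: in_spanZ.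
- exact: IH.
Qed.

(* The test point of [e_k, .., e_1] has vertical part [e_1, e_2] + [e_3, e_4] + ..
   and, for [k] odd, horizontal part [e_k]. *)
Fixpoint test_point (s : seq V1) : V1 * V2 :=
  if s is e :: s' then
    (if odd (size s') then 0 else e,
     (test_point s').2 + br (test_point s').1 e)
  else (0, 0).

Lemma test_point_even s : ~~ odd (size s) -> (test_point s).1 = 0.
Proof. by case: s => //= e s; rewrite negbK => ->. Qed.

(** At the test point of [s] the contraction is a combination of values of [f] at test points of [s]
    or of its tail, with or without [e] put in front. *)
Lemma contract_test_point e f s :
  (forall s', subseq s' s -> f (test_point s') = 0) ->
  (forall s', subseq s' s -> f (test_point (e :: s')) = 0) ->
  contract e f (test_point s) = 0.
Proof.
rewrite /contract => fs fes; have := fes s (subseq_refl s); have := fs s (subseq_refl s).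
have [os|os] := boolP (odd (size s)); last first.
  have s1 := test_point_even os.
  rewrite /= (negbTE os) [test_point s]surjective_pairing s1 /= br0l addr0 => -> ->.
  by rewrite mulr0 subrr addr0.
case: s os fs fes => // i s /= os fs fes; rewrite os (negbTE os) /=.
have s1 := test_point_even os.
have := fs s (subseq_cons s i); have := fes s (subseq_cons s i).
rewrite /= (negbTE os) {3}[test_point s]surjective_pairing s1 !br0l !addr0.
by move=> -> -> _ ->; rewrite mulr0 subrr addr0.
Qed.

Lemma split_affine_eq0 s f : split_affine f ->
  (forall s', subseq s' s -> f (test_point s') = 0) ->
  forall x z, in_span s x -> in_span2 s z -> f (x, z) = 0.
Proof.
elim: s f => [|e s IH] f fS f0 x z /=; first by move=> -> ->; exact: (f0 [::]).
move=> [c [x' [sx ->]]] [y [z' [sy sz ->]]].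
have fs s' : subseq s' s -> f (test_point s') = 0.
  by move=> ss; apply: f0; exact: subseq_trans ss (subseq_cons _ _).
have fes s' : subseq s' s -> f (test_point (e :: s')) = 0.
  by move=> ss; apply: f0; rewrite /= eqxx.
have g0 := IH _ (contract_split e fS); rewrite contract_expansion // (IH f) //.
have {}g0 u w : in_span s u -> in_span2 s w -> contract e f (u, w) = 0.
  move=> su sw; apply: g0 => // s' ss; apply: contract_test_point => s'' ss'.
    exact/fs/(subseq_trans ss').
  exact/fes/(subseq_trans ss').
rewrite !g0 ?mulr0 ?addr0 ?subrr //; try exact: in_span0.
rewrite addrC -[br y x']scale1r; apply: in_span2P => //; exact: in_span2_br.
Qed.

Lemma split_affine_dil s f : split_affine f ->
  forall x z, in_span s x -> in_span2 s z ->
  exists q : {poly R}, (size q <= (size s).+1)%N /\ forall t, f (dil t (x, z)) = q.[t].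
Proof.
elim: s f => [|e s IH] f fS x z /=.
  move=> -> ->; exists (f (0, 0))%:P; split; first exact: size_polyC_leq1.
  by move=> t; rewrite hornerC /dil !scaler0.
move=> [c [x' [sx ->]]] [y [z' [sy sz ->]]].
have gS := contract_split e fS; have [gH gV _] := gS.
have [q1 [s1 q1E]] := IH _ fS _ _ sx sz.
have [q2 [s2 q2E]] := IH _ gS _ _ sy sz.
have [q3 [s3 q3E]] := IH _ gS _ _ (in_span0 s) sz.
have sz' : in_span2 s (z' + br y x').
  by rewrite addrC -[br y x']scale1r; apply: in_span2P => //; exact: in_span2_br.
have [q4 [s4 q4E]] := IH _ gS _ _ (in_span0 s) sz'.
(* In the expansion at the dilated point, the contraction has arguments with one factor [t] more
   than a dilation provides. Its affinity ([gH], [gV]) extracts this factor as ['X], and the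
   leftover values at [(0, t ^+ 2 *: z')] cancel. *)
exists (q1 + (q2 + c *: q3 - q4) * 'X); split.
  rewrite (leq_trans (size_polyD _ _)) // geq_max (leq_trans s1) //=.
  rewrite (leq_trans (size_polyMleq _ _)) // size_polyX addn2 /= ltnS.
  rewrite (leq_trans (size_polyD _ _)) // geq_max size_polyN s4 andbT.
  rewrite (leq_trans (size_polyD _ _)) // geq_max s2 /=.
  exact: leq_trans (size_scale_leq _ _) s3.
move=> t; rewrite !hornerE -q1E -q2E -q3E -q4E /dil /=.
have -> : t *: (c *: e + x') = (t * c) *: e + t *: x' by rewrite scalerDr scalerA.
have -> : t ^+ 2 *: (z' + br y e) = t ^+ 2 *: z' + br (t *: (t *: y)) e.
  by rewrite scalerDr !brE scalerA expr2.
rewrite contract_expansion //.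
have := gH (t *: y) 0 (t ^+ 2 *: z') t 0; rewrite !scaler0 addr0 mul0r addr0 => ->.
have -> : br (t *: (t *: y)) (t *: x') = t *: (t ^+ 2 *: br y x').
  by rewrite !brE !scalerA; congr (_ *: _); ring.
rewrite -brZl gV brZl -scalerDr; ring.
Qed.
End StepTwo.

Section HAffineSum.
Variables (R : realType) (V1 V2 : vectType R) (br : V1 -> V1 -> V2).
Implicit Types f : V1 * V2 -> R.

Lemma h_affine_sum (r : seq nat) (F : nat -> V1 * V2 -> R) :
  (forall k, k \in r -> h_affine br (F k)) ->
  h_affine br (fun p => \sum_(k <- r) F k p).
Proof.
elim: r => [|k r IH] FA p y; first by exists 0, 0 => t; rewrite big_nil mul0r addr0.
have [|a [b ab]] := FA k _ p y; first exact: mem_head.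
have [|a' [b' ab']] := IH _ p y; first by move=> i ir; apply: FA; rewrite inE ir orbT.
by exists (a + a'), (b + b') => t; rewrite big_cons ab ab'; ring.
Qed.

Lemma h_affineB f f' : h_affine br f -> h_affine br f' ->
  h_affine br (fun p => f p - f' p).
Proof.
move=> fA fA' p y; have [a [b ab]] := fA p y; have [a' [b' ab']] := fA' p y.
by exists (a - a'), (b - b') => t; rewrite ab ab'; ring.
Qed.
End HAffineSum.

(** * Exterior algebra in coordinates *)

Section Exterior.
Variables (n : nat) (R : realType).
Implicit Types (A B C S T : {set 'I_n}) (a b c x y z w eta xi : Lam n R).

(** As a product over pairs, the sign is visibly multiplicative in each argument under disjoint
    union. *)
Lemma wsgn_prod A B : wsgn R A B =
  \prod_(i in A) \prod_(j in B) (if (j < i)%N then -1 else 1).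
Proof.
rewrite /wsgn -prodr_const pair_big /= -big_mkcondr /=.
by apply: eq_bigl => -[i j] /=; rewrite inE andbA.
Qed.

Lemma wsgn_splitr A B C : B \subset C -> wsgn R A C = wsgn R A B * wsgn R A (C :\: B).
Proof.
move=> sBC; rewrite !wsgn_prod -big_split; apply: eq_bigr => i _ /=.
by rewrite (big_setID B) /= (setIidPr sBC).
Qed.

Lemma wsgn_splitl A B C : A \subset B -> wsgn R B C = wsgn R A C * wsgn R (B :\: A) C.
Proof. by move=> sAB; rewrite !wsgn_prod (big_setID A) /= (setIidPr sAB). Qed.

Lemma wsgn_neq0 A B : wsgn R A B != 0.
Proof. by rewrite signr_eq0. Qed.

Lemma wsgnC A B : [disjoint A & B] -> wsgn R A B = (-1) ^+ (#|A| * #|B|) * wsgn R B A.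
Proof.
move=> dAB; suff <- : wsgn R A B * wsgn R B A = (-1) ^+ (#|A| * #|B|).
  by rewrite -mulrA -expr2 sqrr_sign mulr1.
(* Each pair of distinct indices is an inversion in exactly one of the two orders, hence one factor
   -1 per pair. *)
rewrite !wsgn_prod [X in _ * X]exchange_big -big_split /= mulnC exprM -prodr_const.
apply: eq_bigr => i iA; rewrite -big_split /= -prodr_const.
apply: eq_bigr => j jB; case: ltngtP => ij; rewrite ?mul1r ?mulr1 //.
by move: dAB => /pred0P /(_ i) /=; rewrite iA -(ord_inj ij) jB.
Qed.

Lemma wedgeDl a b c : wedge (a + b) c = wedge a c + wedge b c.
Proof.
apply/ffunP => S; rewrite !ffunE -big_split; apply: eq_bigr => A _ /=.
by rewrite ffunE; ring.
Qed.

Lemma wedgeDr a b c : wedge a (b + c) = wedge a b + wedge a c.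
Proof.
apply/ffunP => S; rewrite !ffunE -big_split; apply: eq_bigr => A _ /=.
by rewrite ffunE; ring.
Qed.

Lemma LamNE a S : (- a) S = - a S.
Proof. by rewrite ffunE. Qed.

Lemma LamDE a b S : (a + b) S = a S + b S.
Proof. by rewrite ffunE. Qed.

Lemma LamZE (t : R) a S : (t *: a) S = t * a S.
Proof. by rewrite ffunE. Qed.

Lemma wedgeZl (t : R) a b : wedge (t *: a) b = t *: wedge a b.
Proof.
apply/ffunP => S; rewrite LamZE !ffunE mulr_sumr; apply: eq_bigr => A _ /=.
by rewrite LamZE; ring.
Qed.

Lemma wedgeZr (t : R) a b : wedge a (t *: b) = t *: wedge a b.
Proof.
apply/ffunP => S; rewrite LamZE !ffunE mulr_sumr; apply: eq_bigr => A _ /=.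
by rewrite LamZE; ring.
Qed.

Lemma wedge0l a : wedge 0 a = 0.
Proof. by have := wedgeZl 0 0 a; rewrite !scale0r. Qed.

Lemma wedge0r a : wedge a 0 = 0.
Proof. by have := wedgeZr 0 a 0; rewrite !scale0r. Qed.

Definition wedgeE := (wedgeDl, wedgeDr, wedgeZl, wedgeZr, wedge0l, wedge0r).

Lemma wsgn0l A : wsgn R set0 A = 1.
Proof. by rewrite wsgn_prod big_set0. Qed.

Lemma wedge1l a : wedge (wone n R) a = a.
Proof.
apply/ffunP => S; rewrite ffunE (bigD1 set0) ?sub0set //= big1 => [|A /andP[_ A0]].
  by rewrite ffunE eqxx wsgn0l setD0 addr0 !mul1r.
by rewrite ffunE (negbTE A0) mulr0 mul0r.
Qed.

Lemma wedgeA a b c : wedge a (wedge b c) = wedge (wedge a b) c.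
Proof.
apply/ffunP => S; rewrite !ffunE.
transitivity (\sum_(A : {set 'I_n} | A \subset S) \sum_(B : {set 'I_n} | B \subset S :\: A)
   wsgn R A (S :\: A) * a A * (wsgn R B (S :\: A :\: B) * b B * c (S :\: A :\: B))).
  by apply: eq_bigr => A _; rewrite ffunE mulr_sumr.
transitivity (\sum_(D : {set 'I_n} | D \subset S) \sum_(A : {set 'I_n} | A \subset D)
   wsgn R D (S :\: D) * (wsgn R A (D :\: A) * a A * b (D :\: A)) * c (S :\: D)); last first.
  by apply: eq_bigr => D _; rewrite ffunE mulr_sumr mulr_suml.
rewrite [RHS](exchange_big_dep (fun A => A \subset S)) /=; last first.
  by move=> D A sDS sAD; exact: subset_trans sAD sDS.
apply: eq_bigr => A sAS.
(* Both sides range over ordered partitions of [S] into three blocks; on the right the first two are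
   merged into [D = A :|: B]. *)
rewrite [RHS](reindex_onto (fun B => A :|: B) (fun D => D :\: A)) /=; last first.
  move=> D /andP[_ sAD]; apply/setP => i; rewrite !inE.
  by case: (boolP (i \in A)) => //= iA; rewrite (subsetP sAD).
apply: eq_big => [B|B sB].
  rewrite subUset sAS subsetUl andbT /= subsetD.
  rewrite setDUl setDv set0U; congr (_ && _); apply/idP/eqP => [/setDidPl|<-] //.
  by rewrite disjoints_subset setDE subsetIr.
have dBA : (A :|: B) :\: A = B.
  by move: sB; rewrite setDUl setDv set0U subsetD => /andP[_ /setDidPl].
have sBS : B \subset S by move: sB; rewrite subsetD => /andP[].
rewrite dBA (wsgn_splitr _ sB) (@wsgn_splitl A (A :|: B)) ?subsetUl // dBA setDDl.
by ring.
Qed.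

Lemma homog0 k : homog k (0 : Lam n R).
Proof. by move=> S _; rewrite ffunE. Qed.

Lemma homogD k a b : homog k a -> homog k b -> homog k (a + b).
Proof. by move=> ha hb S Sk; rewrite ffunE ha // hb // addr0. Qed.

Lemma homogZ k (t : R) a : homog k a -> homog k (t *: a).
Proof. by move=> ha S Sk; rewrite LamZE ha // mulr0. Qed.

Lemma homog_eq k a b : homog k a -> homog k b ->
  (forall S, #|S| = k -> a S = b S) -> a = b.
Proof.
move=> ha hb ab; apply/ffunP => S; have [/eqP|Sk] := boolP (#|S| == k); first exact: ab.
by rewrite ha // hb.
Qed.

Lemma homog_wedge k l a b : homog k a -> homog l b -> homog (k + l) (wedge a b).
Proof.
move=> ha hb S Sk; rewrite ffunE big1 // => A sAS.
have [/eqP Ak|Ak] := boolP (#|A| == k); last by rewrite (ha A) // mulr0 mul0r.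
rewrite (hb (S :\: A)) ?mulr0 //; apply: contraNneq Sk => SAl.
by rewrite -(cardsID A) (setIidPr sAS) Ak SAl.
Qed.

Lemma homog_gt k a : homog k a -> (n < k)%N -> a = 0.
Proof.
move=> ha nk; apply/ffunP => S; rewrite ha ?ffunE //.
by rewrite neq_ltn (leq_ltn_trans _ nk) // -[X in (_ <= X)%N]card_ord max_card.
Qed.

Lemma wedge_swap k a b S : homog k a ->
  wedge a b S = (-1) ^+ (k * (#|S| - k)) * wedge b a S.
Proof.
move=> ha; rewrite !ffunE mulr_sumr.
rewrite [RHS](reindex_onto (fun A => S :\: A) (fun A => S :\: A)) /=; last first.
  by move=> A sAS; rewrite setDDr setDv set0U (setIidPr sAS).
apply: eq_big => [A|A sAS].
  rewrite subsetDl /= setDDr setDv set0U.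
  by apply/idP/eqP => [/setIidPr|<-] //; exact: subsetIl.
rewrite setDDr setDv set0U (setIidPr sAS).
have [/eqP Ak|Ak] := boolP (#|A| == k); last by rewrite (ha A) // !(mulr0, mul0r).
rewrite (@wsgnC A) ?Ak; last first.
  by rewrite disjoint_sym disjoints_subset setDE subsetIr.
by rewrite -Ak -(cardsID A S) (setIidPr sAS) addKn; ring.
Qed.

Lemma wedgeC_even k z b : ~~ odd k -> homog k z -> wedge z b = wedge b z.
Proof.
move=> ek hz; apply/ffunP => S; rewrite (wedge_swap _ _ hz).
by rewrite -signr_odd oddM (negbTE ek) mul1r.
Qed.

Lemma wedgeCA_even k z b c : ~~ odd k -> homog k z ->
  wedge z (wedge b c) = wedge b (wedge z c).
Proof. by move=> ek hz; rewrite !wedgeA (wedgeC_even b ek hz). Qed.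

Lemma wedgeC1 x y : homog 1 x -> homog 1 y -> wedge x y = - wedge y x.
Proof.
move=> hx hy; apply: (@homog_eq 2) => [||S S2]; first exact: (homog_wedge hx hy).
  by rewrite -scaleN1r; apply: homogZ; exact: (homog_wedge hy hx).
by rewrite (wedge_swap _ _ hx) S2 expr1 mulN1r LamNE.
Qed.

Lemma wedge_xx x : homog 1 x -> wedge x x = 0.
Proof.
move=> hx; have /eqP := wedgeC1 hx hx; rewrite -addr_eq0 -mulr2n -scaler_nat.
by rewrite scaler_eq0 pnatr_eq0 => /eqP.
Qed.

Lemma wedge_sq0 x y : homog 1 x -> homog 1 y ->
  wedge (wedge x y) (wedge x y) = 0.
Proof.
move=> hx hy; rewrite wedgeA -(wedgeA x y x) (wedgeC1 hy hx) -scaleN1r.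
by rewrite wedgeZr wedgeZl wedgeA wedge_xx // !wedge0l scaler0.
Qed.

Lemma homog_wone : homog 0 (wone n R).
Proof. by move=> S; rewrite cards_eq0 ffunE => /negbTE ->. Qed.

Lemma wedge1r a : wedge a (wone n R) = a.
Proof. by rewrite -(wedgeC_even (k := 0)) ?wedge1l //; exact: homog_wone. Qed.

Lemma homog_wpow z j : homog 2 z -> homog j.*2 (wpow z j).
Proof.
move=> hz; elim: j => [|j IH] /=; first exact: homog_wone.
by rewrite doubleS -[(_.+2)]add2n; exact: homog_wedge.
Qed.

Lemma wpowCA z j b c : homog 2 z ->
  wedge (wpow z j) (wedge b c) = wedge b (wedge (wpow z j) c).
Proof.
by move=> hz; apply: (wedgeCA_even _ _ _ (homog_wpow hz)); rewrite odd_double.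
Qed.

Lemma wpowZ (t : R) z j : wpow (t *: z) j = t ^+ j *: wpow z j.
Proof.
elim: j => [|j /= ->]; first by rewrite expr0 scale1r.
by rewrite !wedgeE scalerA exprS.
Qed.

(** Forms of degree 2 commute with all forms and [y] has square zero, so the binomial expansion
    stops at first order. *)
Lemma wpow_add_sq0 z y j (t : R) : homog 2 z -> homog 2 y -> wedge y y = 0 ->
  wpow (z + t *: y) j.+1 = wpow z j.+1 + (t * j.+1%:R) *: wedge (wpow z j) y.
Proof.
move=> hz hy yy; have ey b : wedge y b = wedge b y by exact: wedgeC_even hy.
elim: j => [|j IH]; first by rewrite /= !wedge1r wedge1l mulr1.
have wpowS w i : wpow w i.+1 = wedge w (wpow w i) by [].
rewrite wpowS IH !wedgeE !ey -!wedgeA yy wedge0r !scaler0 addr0 -wpowS.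
rewrite (wedgeA z) -wpowS -addrA -scalerDl.
by congr (_ + _ *: _); rewrite -[j.+2]addn1 natrD; ring.
Qed.

Lemma wpow_add_annihil z y eta j : homog 2 z -> homog 2 y -> wedge y eta = 0 ->
  wedge (wpow (z + y) j) eta = wedge (wpow z j) eta.
Proof.
move=> hz hy ye; elim: j => //= j IH.
rewrite -!wedgeA IH wedgeDl (wedgeCA_even _ _ (isT : ~~ odd 2) hy) ye.
by rewrite wedge0r addr0.
Qed.

(** * Homogeneous parts and nondegeneracy of [psit] *)

Definition hpart k a : Lam n R := [ffun S : {set 'I_n} => if #|S| == k then a S else 0].

Lemma homog_hpart k a : homog k (hpart k a).
Proof. by move=> S /negbTE Sk; rewrite ffunE Sk. Qed.

Lemma hpartP k (t : R) a b : hpart k (t *: a + b) = t *: hpart k a + hpart k b.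
Proof.
apply/ffunP => S; rewrite LamDE LamZE !ffunE.
by case: ifP => // _; rewrite mulr0 addr0.
Qed.

Lemma hpart_id k a : homog k a -> hpart k a = a.
Proof. by move=> ha; apply/ffunP => S; rewrite ffunE; case: ifPn => // /ha. Qed.

Definition dx (i : 'I_n) : Lam n R := [ffun S : {set 'I_n} => (S == [set i])%:R].

Lemma homog_dx i : homog 1 (dx i).
Proof. by move=> S; rewrite ffunE; case: (eqVneq S) => // ->; rewrite cards1. Qed.

Lemma wedge_dx i xi T : i \notin T ->
  wedge (dx i) xi (i |: T) = wsgn R [set i] T * xi T.
Proof.
move=> iT; rewrite ffunE (bigD1 [set i]) ?sub1set ?setU11 //= big1 => [|A /andP[_ Ai]].
  by rewrite addr0 ffunE eqxx mulr1 setU1K.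
by rewrite ffunE (negbTE Ai) mulr0 mul0r.
Qed.

Lemma topcoefE a S : #|S| = n -> topcoef a = a S.
Proof.
move=> Sn; rewrite /topcoef; congr (fun_of_fin a _); apply/esym/eqP.
by rewrite eqEcard subsetT cardsT card_ord Sn leqnn.
Qed.

Lemma notin_ex S : (#|S| < n)%N -> exists i, i \notin S.
Proof.
move=> Sn; have : (0 < #|~: S|)%N by rewrite cardsCs setCK card_ord subn_gt0.
by rewrite card_gt0 => /set0Pn[i]; rewrite inE; exists i.
Qed.

(** Replacing [z] by [z + dx k /\ dx i] and keeping the first-order term transfers the hypothesis to
    [dx k /\ dx i /\ xi] with exponent [j] lowered by one. The coefficient of that form at [T]
    enlarged by [i] and [k] is the one of [xi] at [T], up to sign. *)
Lemma even_nondeg j xi :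
  (forall z, homog 2 z -> topcoef (wedge (wpow z j) xi) = 0) ->
  forall T, (#|T| + j.*2 = n)%N -> xi T = 0.
Proof.
elim: j xi => [|j IH] xi xi0 T.
  rewrite addn0 => Tn; rewrite -(topcoefE _ Tn).
  by have := xi0 0 (@homog0 2); rewrite wedge1l.
rewrite doubleS !addnS => Tn.
have [i iT] : exists i, i \notin T by apply: notin_ex; lia.
have [k kT] : exists k, k \notin i |: T.
  by apply: notin_ex; rewrite cardsU1 iT; lia.
have hk := homog_dx k; have hi := homog_dx i.
have hki := homog_wedge hk hi.
suff : wedge (dx k) (wedge (dx i) xi) (k |: (i |: T)) = 0.
  rewrite wedge_dx // wedge_dx // => /eqP; rewrite !mulf_eq0 !(negbTE (wsgn_neq0 _ _)).
  by move=> /eqP.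
rewrite wedgeA; apply: IH; last by rewrite !cardsU1 kT iT; lia.
move=> z hz; have /= := xi0 (z + 1 *: wedge (dx k) (dx i)) (homogD hz (@homogZ 2 1 _ hki)).
rewrite -[wedge (_ + _) _]/(wpow _ j.+1) wpow_add_sq0 ?wedge_sq0 //.
have := xi0 z hz; rewrite /topcoef wedgeDl wedgeZl LamDE => ->.
rewrite add0r LamZE mul1r -wedgeA => /eqP; rewrite mulf_eq0 pnatr_eq0 /=.
by move=> /eqP.
Qed.

Lemma odd_nondeg j xi :
  (forall x z, homog 1 x -> homog 2 z ->
     topcoef (wedge x (wedge (wpow z j) xi)) = 0) ->
  forall T, (#|T| + j.*2.+1 = n)%N -> xi T = 0.
Proof.
move=> xi0 T; rewrite addnS => Tn.
have [i iT] : exists i, i \notin T by apply: notin_ex; lia.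
suff : wedge (dx i) xi (i |: T) = 0.
  rewrite wedge_dx // => /eqP; rewrite mulf_eq0 (negbTE (wsgn_neq0 _ _)).
  by move=> /eqP.
apply: (@even_nondeg j); last by rewrite cardsU1 iT; lia.
move=> z hz; have := xi0 _ _ (homog_dx i) hz.
by rewrite wpowCA.
Qed.

Lemma psit_nondeg k xi : (k <= n)%N ->
  (forall x z, inFn x z -> psit k xi x z = 0) -> forall T, #|T| = k -> xi T = 0.
Proof.
move=> kn xi0 T Tk; rewrite /psit in xi0.
have := odd_double_half (n - k); case: (boolP (odd _)) xi0 => /= om xi0 E.
  apply: (@odd_nondeg (n - k)./2); last by rewrite Tk; lia.
  by move=> x z hx hz; exact: (xi0 x z (conj hx hz)).
apply: (@even_nondeg (n - k)./2); last by rewrite Tk; lia.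
by move=> z hz; exact: (xi0 0 z (conj (@homog0 1) hz)).
Qed.

Lemma psitP k (t : R) a b x z :
  psit k (t *: a + b) x z = t * psit k a x z + psit k b x z.
Proof. by rewrite /psit /topcoef; case: ifP => _; rewrite !wedgeE !(LamDE, LamZE). Qed.

Lemma psit_hpart k a x z : (k <= n)%N -> inFn x z -> psit k (hpart k a) x z = psit k a x z.
Proof.
move=> kn [hx hz]; apply/eqP; rewrite -subr_eq0 -mulN1r addrC -psitP.
have -> : psit k (-1 *: a + hpart k a) x z = 0; last by [].
have top m b c : homog m b -> (m + k = n)%N -> (forall S, #|S| = k -> c S = 0) ->
    topcoef (wedge b c) = 0.
  move=> hb mk c0; rewrite /topcoef ffunE big1 // => A _.
  have [/eqP Am|Am] := boolP (#|A| == m); last by rewrite (hb A) // mulr0 mul0r.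
  by rewrite c0 ?mulr0 // cardsDS ?subsetT // cardsT card_ord; lia.
have c0 S : #|S| = k -> (-1 *: a + hpart k a) S = 0.
  by move=> Sk; rewrite LamDE LamZE ffunE Sk eqxx mulN1r addNr.
have hp := homog_wpow (j := (n - k)./2) hz; rewrite /psit.
have := odd_double_half (n - k); case: (boolP (odd _)) => /= om E.
  by rewrite wedgeA; apply: top c0; [exact: homog_wedge hx hp | lia].
by apply: top c0; [exact: hp | lia].
Qed.

Lemma psit_scale k eta (t : R) x z :
  psit k eta (t *: x) (t ^+ 2 *: z) = t ^+ (n - k) * psit k eta x z.
Proof.
rewrite /psit /topcoef; have := odd_double_half (n - k).
case: (boolP (odd _)) => /= _ E; rewrite wpowZ !wedgeE !LamZE -exprM mul2n.
  by rewrite mulrA -exprS -[(_.+1)]add1n E.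
by rewrite -[X in t ^+ X * _ = _]add0n E.
Qed.

Lemma psit_kernel k eta x z x0 z0 : inFn x z -> inFn x0 z0 ->
  wedge x0 eta = 0 -> wedge z0 eta = 0 ->
  psit k eta (x + x0) (z + z0) = psit k eta x z.
Proof.
move=> [hx hz] [hx0 hz0] x0e z0e; rewrite /psit wpow_add_annihil //.
case: ifP => // _; rewrite wedgeDl.
rewrite -[wedge x0 _]wpowCA // x0e.
by rewrite wedge0r addr0.
Qed.

Local Arguments wpow : simpl never.

(** Since [wedge x y] has square zero, the power is affine in [t]; in the odd case the term in
    [t ^+ 2] dies because [x] and [y] both annihilate [wedge x y]. *)
Lemma psit_affine k eta x y z : homog 1 x -> homog 1 y -> homog 2 z ->
  exists A B : R, forall t : R,
    psit k eta (x + t *: y) (z + t *: wedge x y) = A + B * t.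
Proof.
move=> hx hy hz; have hxy := homog_wedge hx hy.
have xyxy := wedge_sq0 hx hy.
have xxy : wedge x (wedge x y) = 0 by rewrite wedgeA wedge_xx // wedge0l.
have yxy : wedge y (wedge x y) = 0.
  by rewrite (wedgeC1 hx hy) -scaleN1r wedgeZr wedgeA wedge_xx // wedge0l scaler0.
have kill v j : wedge v (wedge x y) = 0 -> wedge v (wedge (wpow z j) (wedge x y)) = 0.
  by move=> vxy; rewrite -(wpowCA j v (wedge x y) hz) vxy wedge0r.
rewrite /psit; move: (n - k)./2 (odd (n - k)) => [|j] [] /=.
- exists (topcoef (wedge x (wedge (wpow z 0) eta))),
     (topcoef (wedge y (wedge (wpow z 0) eta))) => t.
  by rewrite !wedgeE /topcoef !(LamDE, LamZE); ring.
- by exists (topcoef (wedge (wpow z 0) eta)), 0 => t /=; rewrite mul0r addr0.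
- exists (topcoef (wedge x (wedge (wpow z j.+1) eta))),
     (topcoef (wedge y (wedge (wpow z j.+1) eta))) => t.
  have xyk : wedge (x + t *: y) (wedge (wpow z j) (wedge x y)) = 0.
    by rewrite wedgeDl wedgeZl !kill // scaler0 addr0.
  rewrite wpow_add_sq0 // [wedge (_ + _) eta]wedgeDl wedgeZl wedgeDr wedgeZr.
  rewrite (wedgeA (x + t *: y) (wedge (wpow z j) (wedge x y)) eta) xyk wedge0l.
  by rewrite scaler0 addr0 wedgeDl wedgeZl /topcoef !(LamDE, LamZE); ring.
- exists (topcoef (wedge (wpow z j.+1) eta)),
    (j.+1%:R * topcoef (wedge (wedge (wpow z j) (wedge x y)) eta)) => t.
  rewrite wpow_add_sq0 // wedgeDl wedgeZl.
  by rewrite /topcoef !(LamDE, LamZE); ring.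
Qed.

End Exterior.

(** * The free group *)

Section Polynomials.
Variable R : realType.

Lemma poly_eq_pos (p q : {poly R}) : (forall t, 0 < t -> p.[t] = q.[t]) -> p = q.
Proof.
move=> pq; apply/eqP; rewrite -subr_eq0; apply/eqP.
apply: (@roots_geq_poly_eq0 _ _ [seq i.+1%:R | i <- iota 0 (size (p - q))]).
- apply/allP => _ /mapP[i _ ->]; by rewrite rootE hornerD hornerN pq ?subrr ?ltr0n.
- by rewrite map_inj_uniq ?iota_uniq // => i j /eqP; rewrite eqr_nat => /eqP [].
- by rewrite size_map size_iota.
Qed.

(** The polynomial in [t] of a sum of [psi] along dilations: the component of form degree [k], with
    value [c k], has weight [n - k]. *)
Definition dil_poly n m (c : nat -> R) : {poly R} :=
  \sum_(m <= k < n.+1) c k *: 'X^(n - k).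

Lemma horner_dil_poly n m c t :
  (dil_poly n m c).[t] = \sum_(m <= k < n.+1) t ^+ (n - k) * c k.
Proof.
rewrite /dil_poly horner_sum; apply: eq_bigr => k _.
by rewrite hornerZ hornerXn mulrC.
Qed.

Lemma coef_dil_poly n m c k : (m <= k <= n)%N -> (dil_poly n m c)`_(n - k) = c k.
Proof.
move=> /andP[mk kn]; rewrite /dil_poly coef_sum.
rewrite (bigD1_seq k) ?iota_uniq ?mem_index_iota ?mk //=.
rewrite coefZ coefXn eqxx mulr1 big1_seq ?addr0 // => i /andP[ik].
rewrite mem_index_iota => /andP[_ ilt]; rewrite coefZ coefXn.
by case: eqP => [E|_]; [move/eqP: ik; lia | rewrite mulr0].
Qed.

Lemma derive1n_horner (p : {poly R}) j :
  @derive1n R R^o j (fun t => (p.[t] : R^o)) = (fun t => (p^`(j)).[t]).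
Proof.
elim: j => [|j IH]; first by rewrite derive1n0.
by rewrite derive1nS IH derivnS; apply/esym/derivE.
Qed.
End Polynomials.

Section Free.
Variables (n : nat) (R : realType).
Implicit Types (S T : {set 'I_n}) (x y z eta xi : Lam n R).

(** Projecting to degree 1 makes the bracket bilinear and skew on all of [Lam n R], so the step-two
    results apply; the free group itself is the part cut out by [inFn]. *)
Definition free_br x y : Lam n R := wedge (hpart 1 x) (hpart 1 y).

Lemma free_br_linl (a : R) x y z :
  free_br (a *: x + y) z = a *: free_br x z + free_br y z.
Proof. by rewrite /free_br hpartP wedgeDl wedgeZl. Qed.

Lemma free_br_skew x y : free_br x y = - free_br y x.
Proof. by apply: wedgeC1; exact: homog_hpart. Qed.

Definition free_basis : seq (Lam n R) := [seq dx R i | i <- enum 'I_n].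

Lemma in_span_free x : homog 1 x -> in_span free_basis x.
Proof.
move=> hx; have -> : x = \sum_(i : 'I_n) x [set i] *: dx R i.
  apply: (homog_eq hx) => [|S /eqP/cards1P[i ->]].
    by elim/big_ind: _ => [|a b|i _]; [exact: homog0 | exact: homogD |
      exact/homogZ/homog_dx].
  rewrite sum_ffunE (bigD1 i) //= big1 ?addr0 => [|k ki]; rewrite LamZE ffunE.
    by rewrite eqxx mulr1.
  by rewrite (inj_eq set1_inj) eq_sym (negbTE ki) mulr0.
elim/big_ind: _ => [|a b sa sb|i _]; first exact: in_span0.
  by rewrite -[a]scale1r; exact: in_spanP.
by apply/in_spanZ/in_span_mem/map_f; rewrite mem_enum.
Qed.

Lemma wedge_dx_dx (i k : 'I_n) : i != k ->
  wedge (dx R i) (dx R k) =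
  wsgn R [set i] [set k] *: [ffun S : {set 'I_n} => (S == [set i; k])%:R].
Proof.
move=> ik; apply/ffunP => S; rewrite LamZE [in RHS]ffunE.
have [->|Sik] := eqVneq S [set i; k].
  by rewrite wedge_dx ?inE // ffunE eqxx.
rewrite mulr0 ffunE big1 // => A sAS; rewrite !ffunE.
case: (eqVneq A) => [Ai|]; last by rewrite mulr0 mul0r.
case: (eqVneq (S :\: A)) => [SAk|]; last by rewrite mulr0.
by case/eqP: Sik; rewrite -[LHS](setID S A) (setIidPr sAS) SAk Ai.
Qed.

Lemma in_span2_free z : homog 2 z -> in_span2 free_br free_basis z.
Proof.
move=> hz; pose e S : Lam n R := [ffun T : {set 'I_n} => (T == S)%:R].
have -> : z = \sum_(S : {set 'I_n} | #|S| == 2) z S *: e S.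
  apply/ffunP => S; rewrite sum_ffunE; have [S2|S2] := boolP (#|S| == 2).
    rewrite (bigD1 S) //= big1 => [|T /andP[_ TS]]; rewrite LamZE ffunE.
      by rewrite eqxx mulr1 addr0.
    by rewrite eq_sym (negbTE TS) mulr0.
  rewrite hz // big1 // => T T2; rewrite LamZE ffunE.
  by case: (eqVneq S) T2 S2 => [<- ->|]; rewrite ?mulr0.
have P := in_span2P free_br_linl.
have s0 := in_span20 free_br_linl free_basis.
apply: (big_ind (in_span2 free_br free_basis)) => // [a b sa sb|S S2].
  by rewrite -[a]scale1r; exact: P.
have /cards2P[i [k [ik ->]]] := S2.
have -> : e [set i; k] = (wsgn R [set i] [set k])^-1 *: free_br (dx R i) (dx R k).
  rewrite /free_br !hpart_id ?wedge_dx_dx ?scalerA ?mulVf ?wsgn_neq0 ?scale1r //;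
  exact: homog_dx.
rewrite scalerA -[_ *: _]addr0; apply: P => //.
by apply: in_span2_br; [exact: free_br_linl | exact: free_br_skew | |];
  apply/in_span_free/homog_dx.
Qed.

Definition subset_seq S : seq (Lam n R) := [seq dx R i | i <- enum S].

Lemma subseq_free_basis s : subseq s free_basis -> exists S, s = subset_seq S.
Proof.
move=> /subseqP[m sm ->]; exists [set i in mask m (enum 'I_n)].
rewrite /subset_seq /free_basis -map_mask; congr map.
have := mask_subseq m (enum 'I_n); move: (mask m _) => u /(subseq_uniqP (enum_uniq _)).
move=> uE; rewrite [LHS]uE enumT [RHS]/enum_mem.
by apply: eq_filter => i; rewrite !inE.
Qed.

(** One inhomogeneous form encodes a whole tuple, as [psit k] reads only its part of degree [k]. *)
Definition form_fun eta (p : Lam n R * Lam n R) : R :=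
  \sum_(0 <= k < n.+1) psit k eta (hpart 1 p.1) (hpart 2 p.2).

Lemma form_fun_h_affine eta : h_affine free_br (form_fun eta).
Proof.
apply: (@h_affine_sum _ _ _ free_br _
  (fun k p => psit k eta (hpart 1 p.1) (hpart 2 p.2))) => k _ [x z] y.
have [A [B AB]] := psit_affine k eta (homog_hpart (k := 1) x)
  (homog_hpart (k := 1) y) (homog_hpart (k := 2) z).
exists A, B => t; rewrite -AB /cmul /= addr0 /free_br.
congr (psit k eta _ _).
  by rewrite addrC hpartP addrC.
rewrite -[z]scale1r hpartP !scale1r; congr (_ + _).
have -> : hpart 1 (t *: y) = t *: hpart 1 y.
  by rewrite -[t *: y]addr0 hpartP (hpart_id (@homog0 n R 1)) addr0.
rewrite wedgeZr hpart_id //; apply: homogZ.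
by apply: (@homog_wedge _ _ 1 1); exact: homog_hpart.
Qed.

Lemma form_fun_dil eta x z t : inFn x z ->
  form_fun eta (t *: x, t ^+ 2 *: z) = (dil_poly n 0 (fun k => psit k eta x z)).[t].
Proof.
move=> [hx hz]; rewrite horner_dil_poly; apply: eq_bigr => k _ /=.
by rewrite !hpart_id ?psit_scale //; exact: homogZ.
Qed.

(** Indexing the test points by subsets turns evaluation into an endomorphism of [Lam n R], so that
    injectivity will imply surjectivity. *)
Definition form_values eta : Lam n R :=
  [ffun S : {set 'I_n} => form_fun eta (test_point free_br (subset_seq S))].

Lemma form_values_linear : linear form_values.
Proof.
move=> a eta xi; apply/ffunP => S; rewrite LamDE LamZE !ffunE mulr_sumr -big_split.
by apply: eq_bigr => k _; rewrite psitP.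
Qed.

HB.instance Definition _ :=
  GRing.isLinear.Build R (Lam n R) (Lam n R) _ form_values form_values_linear.

Lemma h_affine_free_eq0 F : h_affine free_br F ->
  (forall S, F (test_point free_br (subset_seq S)) = 0) ->
  forall x z, inFn x z -> F (x, z) = 0.
Proof.
move=> FA F0 x z [hx hz].
apply: (split_affine_eq0 free_br_linl free_br_skew (s := free_basis)).
- exact: (h_affine_split free_br_linl free_br_skew FA).
- by move=> s /subseq_free_basis[S ->].
- exact: in_span_free.
- exact: in_span2_free.
Qed.

(** Vanishing at the test points forces vanishing on the free group; dilations then separate the
    degrees, and [psit_nondeg] removes each coefficient. *)
Lemma form_values_inj eta : form_values eta = 0 -> eta = 0.
Proof.
move=> eta0; apply/ffunP => S; rewrite ffunE.
apply: (@psit_nondeg n R #|S|) => // [|x z xz].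
  by rewrite -[X in (_ <= X)%N]card_ord max_card.
have F0 x' z' : inFn x' z' -> form_fun eta (x', z') = 0.
  apply: h_affine_free_eq0 => [|T]; first exact: form_fun_h_affine.
  by have := congr1 (fun a : Lam n R => a T) eta0; rewrite !ffunE.
have P0 : dil_poly n 0 (fun k => psit k eta x z) = 0.
  apply: poly_eq_pos => t _; rewrite -form_fun_dil // horner0 F0 //.
  by case: xz => hx hz; split; exact: homogZ.
have := @coef_dil_poly R n 0 (fun k => psit k eta x z) #|S|.
rewrite P0 coef0 => <- //=.
by rewrite -[X in (_ <= X)%N]card_ord max_card.
Qed.

Lemma form_values_surj a : exists eta, form_values eta = a.
Proof.
have ker0 : lker (linfun form_values) == 0%VS.
  apply/lker0P => u v; rewrite !lfunE => uv; apply/eqP; rewrite -subr_eq0.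
  by apply/eqP/form_values_inj; rewrite linearB /= uv subrr.
exists ((linfun form_values)^-1%VF a).
by have := lker0_lfunVK ker0 a; rewrite lfunE.
Qed.

Lemma h_affine_free F : h_affine free_br F ->
  exists eta, forall x z, inFn x z -> F (x, z) = \sum_(0 <= k < n.+1) psit k eta x z.
Proof.
move=> FA.
have [eta etaF] := form_values_surj
  [ffun S : {set 'I_n} => F (test_point free_br (subset_seq S))].
exists eta => x z xz; have [hx hz] := xz.
transitivity (form_fun eta (x, z)); last first.
  by rewrite /form_fun /= !hpart_id.
apply/eqP; rewrite -subr_eq0; apply/eqP.
apply: (@h_affine_free_eq0 (fun p => F p - form_fun eta p)) => // [|S].
  exact: (h_affineB FA (form_fun_h_affine eta)).
have := congr1 (fun a : Lam n R => a S) etaF; rewrite !ffunE => ->.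
by rewrite subrr.
Qed.

Lemma wedge_dx2 (i k : 'I_n) T xi : i \notin T -> k \notin i |: T ->
  wedge (wedge (dx R k) (dx R i)) xi (k |: (i |: T)) = 0 -> xi T = 0.
Proof.
move=> iT kT; rewrite -wedgeA wedge_dx // wedge_dx // => /eqP.
by rewrite !mulf_eq0 !(negbTE (wsgn_neq0 _ _ _)) => /eqP.
Qed.

(** Polarizing along [dx k /\ dx i] passes the invariance from [xi] to [dx k /\ dx i /\ xi] with the
    exponent lowered by one; at exponent one it says that [wedge z0 xi] has zero top coefficient. *)
Lemma wpow_invariant z0 j xi : homog 2 z0 ->
  (forall z, homog 2 z ->
    topcoef (wedge (wpow (z + z0) j.+1) xi) = topcoef (wedge (wpow z j.+1) xi)) ->
  forall T, (#|T| + j.*2 = n)%N -> wedge z0 xi T = 0.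
Proof.
move=> hz0; elim: j xi => [|j IH] xi inv T.
  rewrite addn0 => Tn; have := inv 0 (@homog0 n R 2).
  rewrite /= !wedge1r add0r wedge0l [X in _ = X]/topcoef ffunE => <-.
  by rewrite (topcoefE _ Tn).
rewrite doubleS !addnS => Tn.
have [i iT] : exists i, i \notin T by apply: notin_ex; lia.
have [k kT] : exists k, k \notin i |: T by apply: notin_ex; rewrite cardsU1 iT; lia.
have hk := homog_dx R k; have hi := homog_dx R i; have hki := homog_wedge hk hi.
apply: (wedge_dx2 iT kT); rewrite (wedgeCA_even _ _ (isT : ~~ odd 2) hki).
apply: IH; last by rewrite !cardsU1 kT iT; lia.
move=> z hz; have hz' := homogD hz (@homogZ n R 2 1 _ hki).
have inv1 := inv z hz; have := inv _ hz'.
rewrite addrAC !wpow_add_sq0 ?wedge_sq0 //; last exact: homogD.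
rewrite /topcoef in inv1 *.
rewrite !wedgeDl !wedgeZl !LamDE !LamZE inv1 => /addrI /mulfI.
by rewrite mul1r -!wedgeA => -> //; rewrite pnatr_eq0.
Qed.

End Free.

(** * Descent along a morphism *)

Section Morphism.
Variables (n : nat) (R : realType) (V1 V2 : vectType R) (br : V1 -> V1 -> V2).
Hypothesis br_linl :
  forall (a : R) (x y w : V1), br (a *: x + y) w = a *: br x w + br y w.
Hypothesis br_skew : forall x y : V1, br x y = - br y x.
Variables (pi1 : Lam n R -> V1) (pi2 : Lam n R -> V2).
Hypothesis piM : carnot_morphism br pi1 pi2.
Hypothesis piS : carnot_surj pi1 pi2.
Implicit Types (x z eta xi : Lam n R).

Lemma pi1_0 : pi1 0 = 0.
Proof.
have := piM.1 1 0 0 (@homog0 n R 1) (@homog0 n R 1).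
by rewrite !scale1r addr0 -{1}[pi1 0]addr0 => /addrI.
Qed.

Lemma pi2_0 : pi2 0 = 0.
Proof.
have := piM.2.1 1 0 0 (@homog0 n R 2) (@homog0 n R 2).
by rewrite !scale1r addr0 -{1}[pi2 0]addr0 => /addrI.
Qed.

Lemma pi1D x x' : homog 1 x -> homog 1 x' -> pi1 (x + x') = pi1 x + pi1 x'.
Proof. by move=> hx hx'; have := piM.1 1 _ _ hx hx'; rewrite !scale1r. Qed.

Lemma pi2D z z' : homog 2 z -> homog 2 z' -> pi2 (z + z') = pi2 z + pi2 z'.
Proof. by move=> hz hz'; have := piM.2.1 1 _ _ hz hz'; rewrite !scale1r. Qed.

Lemma pi1Z (t : R) x : homog 1 x -> pi1 (t *: x) = t *: pi1 x.
Proof.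
by move=> hx; have := piM.1 t _ _ hx (@homog0 n R 1); rewrite pi1_0 !addr0.
Qed.

Lemma pi2Z (t : R) z : homog 2 z -> pi2 (t *: z) = t *: pi2 z.
Proof.
by move=> hz; have := piM.2.1 t _ _ hz (@homog0 n R 2); rewrite pi2_0 !addr0.
Qed.

Lemma psit_invariant_LamPi k xi : (k <= n)%N -> homog k xi ->
  (forall x z x0 z0, inFn x z -> inFn x0 z0 -> pi1 x0 = 0 -> pi2 z0 = 0 ->
    psit k xi (x + x0) (z + z0) = psit k xi x z) ->
  LamPi pi1 pi2 k xi.
Proof.
move=> kn hxi inv; split=> //.
have kill z0 : homog 2 z0 -> pi2 z0 = 0 -> wedge z0 xi = 0.
  move=> hz0 piz0; have hz0xi := homog_wedge hz0 hxi.
  have [nk|nk] := ltnP n (2 + k); first exact: homog_gt hz0xi nk.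
  have {}inv x z : inFn x z -> psit k xi x (z + z0) = psit k xi x z.
    move=> xz; rewrite -[in LHS](addr0 x); apply: inv => //; last exact: pi1_0.
    by split=> //; exact: homog0.
  apply: (homog_eq hz0xi (@homog0 _ _ _)) => T Tk; rewrite [RHS]ffunE.
  have := odd_double_half (n - k); rewrite /psit in inv.
  have [j jE] : exists j, ((n - k)./2 = j.+1)%N by exists ((n - k)./2.-1); lia.
  rewrite jE in inv *.
  case: (boolP (odd _)) inv => /= ok inv E; last first.
    apply: (@wpow_invariant n R z0 j) => // [z hz|]; last by rewrite Tk; lia.
    exact: (inv 0 z (conj (@homog0 _ _ 1) hz)).
  (* For [n - k] odd, taking [dx i] as horizontal part turns [psit] into the even pairing with
     [dx i /\ xi]. *)
  have [i iT] : exists i, i \notin T by apply: notin_ex; rewrite Tk; lia.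
  suff : wedge (dx R i) (wedge z0 xi) (i |: T) = 0.
    by rewrite wedge_dx // => /eqP; rewrite mulf_eq0 (negbTE (wsgn_neq0 _ _ _)) => /eqP.
  rewrite -(wedgeCA_even _ _ (isT : ~~ odd 2) hz0).
  apply: (@wpow_invariant n R z0 j) => // [z hz|]; last by rewrite cardsU1 iT Tk; lia.
  rewrite !wpowCA //; last exact: homogD.
  exact: (inv _ z (conj (homog_dx R i) hz)).
move=> x0 z0 [hx0 hz0] pix0 piz0; split; last exact: kill.
have hx0xi := homog_wedge hx0 hxi.
have [nk|nk] := ltnP n (1 + k); first exact: homog_gt hx0xi nk.
apply: (homog_eq hx0xi (@homog0 _ _ _)) => T Tk; rewrite [RHS]ffunE.
(* If [1 + k < n], the form [dx i /\ x0] lies in the kernel of [pi2], its image being a bracket with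
   0, and [kill] applies. If [1 + k = n], [psit] is the pairing [x0 /\ xi] itself, and invariance at
   the origin suffices. *)
have [nk'|nk'] := ltnP (1 + k) n.
  have [i iT] : exists i, i \notin T by apply: notin_ex; rewrite Tk.
  suff : wedge (dx R i) (wedge x0 xi) (i |: T) = 0.
    by rewrite wedge_dx // => /eqP; rewrite mulf_eq0 (negbTE (wsgn_neq0 _ _ _)) => /eqP.
  have hix0 := homog_wedge (homog_dx R i) hx0.
  rewrite wedgeA kill // ?ffunE // piM.2.2 //; last exact: homog_dx.
  by rewrite pix0 (br0r br_linl br_skew).
have nk1 : (n - k = 1)%N by lia.
have h00 : inFn (0 : Lam n R) 0 by split; exact: homog0.
have := inv 0 0 x0 0 h00 (conj hx0 (@homog0 _ _ 2)) pix0 pi2_0.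
rewrite /psit nk1 /= add0r !wedge1l wedge0l [X in _ = X]ffunE => <-.
by rewrite (@topcoefE _ _ _ T) // Tk; lia.
Qed.

(** The chosen preimage differs from [(x, z)] by an element of the kernel, which annihilates
    [eta]. *)
Lemma psit_psi k eta : LamPi pi1 pi2 k eta -> forall x z, inFn x z ->
  psit k eta x z = psi pi1 pi2 k eta (pi1 x, pi2 z).
Proof.
move=> [_ ann] x z xz; have [hx hz] := xz; rewrite /psi.
case: pselect => [H|[]]; last by exists (x, z).
have := projT2 (cid H); set p := projT1 _ => -[[h1 h2] [e1 e2]].
have hx0 : homog 1 (-1 *: x + p.1) by apply: homogD => //; exact: homogZ.
have hz0 : homog 2 (-1 *: z + p.2) by apply: homogD => //; exact: homogZ.
have [|||a1 a2] := ann (-1 *: x + p.1) (-1 *: z + p.2).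
- by split.
- by rewrite piM.1 // e1 scaleN1r addNr.
- by rewrite piM.2.1 // e2 scaleN1r addNr.
have := psit_kernel k xz (conj hx0 hz0) a1 a2.
by rewrite !scaleN1r !addNKr => ->.
Qed.

Lemma psi_unique k eta ps : LamPi pi1 pi2 k eta ->
  (forall x z, inFn x z -> psit k eta x z = ps (pi1 x, pi2 z)) ->
  forall g, ps g = psi pi1 pi2 k eta g.
Proof.
by move=> L psE g; have [x [z [xz <-]]] := piS g; rewrite -psit_psi // psE.
Qed.

(** The preimage is chosen from [g] alone, independently of the form, so linearity is inherited from
    [psit]. *)
Lemma psi_linear k (a : R) eta xi g :
  psi pi1 pi2 k (a *: eta + xi) g = a * psi pi1 pi2 k eta g + psi pi1 pi2 k xi g.
Proof.
by rewrite /psi; case: pselect => [H|_]; [rewrite /= psitP | rewrite mulr0 addr0].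
Qed.

Lemma psi_dil k eta (t : R) g : LamPi pi1 pi2 k eta ->
  psi pi1 pi2 k eta (dil t g) = t ^+ (n - k) * psi pi1 pi2 k eta g.
Proof.
move=> L; have [x [z [xz <-]]] := piS g; have [hx hz] := xz.
rewrite /dil /= -pi1Z // -pi2Z // -!psit_psi ?psit_scale //.
by split; exact: homogZ.
Qed.

(** By surjectivity a horizontal line lifts to one of the free group, where [psit_affine]
    applies. *)
Lemma psi_h_affine k eta : LamPi pi1 pi2 k eta -> h_affine br (psi pi1 pi2 k eta).
Proof.
move=> L g y; have [x [z [xz <-]]] := piS g; have [hx hz] := xz.
have [x' [z' [[hx' _] [yE _]]]] := piS (y, 0).
have [A [B AB]] := psit_affine k eta hx hx' hz; exists A, B => t.
have hxx' := homog_wedge hx hx'.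
rewrite -AB (psit_psi L); last first.
  by split; apply: homogD => //; exact: homogZ.
rewrite pi1D ?pi2D ?pi1Z ?pi2Z //; try exact: homogZ.
by rewrite piM.2.2 // yE /cmul /= addr0 (brZr br_linl br_skew).
Qed.

Lemma h_affine_pullback f : h_affine br f ->
  h_affine (@free_br n R) (fun p => f (pi1 (hpart 1 p.1), pi2 (hpart 2 p.2))).
Proof.
move=> fA [x z] y; set hp := @homog_hpart n R.
have [A [B AB]] := fA (pi1 (hpart 1 x), pi2 (hpart 2 z)) (pi1 (hpart 1 y)).
exists A, B => t; rewrite -AB /cmul /=; congr (f (_, _)).
  by rewrite addrC hpartP addrC pi1D ?pi1Z //; exact: homogZ.
have hw : homog 2 (wedge (hpart 1 x) (hpart 1 y)).
  exact: (homog_wedge (hp 1%N x) (hp 1%N y)).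
rewrite !addr0 -[z]scale1r hpartP !scale1r /free_br.
have -> : hpart 1 (t *: y) = t *: hpart 1 y.
  by rewrite -[t *: y]addr0 hpartP (hpart_id (@homog0 n R 1)) addr0.
rewrite wedgeZr (hpart_id (homogZ t hw)) pi2D ?pi2Z //; last exact: homogZ.
by rewrite piM.2.2 // (brZr br_linl br_skew).
Qed.

Lemma h_affine_forms f : h_affine br f -> exists eta : nat -> Lam n R,
  (forall k, (k <= n)%N -> LamPi pi1 pi2 k (eta k)) /\
  forall g, f g = \sum_(0 <= k < n.+1) psi pi1 pi2 k (eta k) g.
Proof.
move=> fA; have [eta etaE] := h_affine_free (h_affine_pullback fA).
have fE x z : inFn x z -> f (pi1 x, pi2 z) = \sum_(0 <= k < n.+1) psit k eta x z.
  by move=> xz; have := etaE _ _ xz; case: xz => hx hz; rewrite /= !hpart_id.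
have fP x z t : inFn x z -> f (pi1 (t *: x), pi2 (t ^+ 2 *: z)) =
    (dil_poly n 0 (fun k => psit k eta x z)).[t].
  move=> [hx hz]; rewrite fE; last by split; exact: homogZ.
  by rewrite horner_dil_poly; apply: eq_bigr => k _; rewrite psit_scale.
(* The kernel is stable under dilations, so the invariance of the total sum holds at every [t];
   comparing coefficients gives it degree by degree. *)
have L k : (k <= n)%N -> LamPi pi1 pi2 k (hpart k eta).
  move=> kn; apply: psit_invariant_LamPi => // [|x z x0 z0 xz xz0 p1 p2].
    exact: homog_hpart.
  have [hx hz] := xz; have [hx0 hz0] := xz0.
  have xz' : inFn (x + x0) (z + z0) by split; exact: homogD.
  rewrite !psit_hpart //.
  have := @coef_dil_poly R n 0 (fun k => psit k eta x z) k kn => /= <-.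
  have := @coef_dil_poly R n 0 (fun k => psit k eta (x + x0) (z + z0)) k kn => /= <-.
  apply: (congr1 (fun p : {poly R} => p`_(n - k))); apply: poly_eq_pos => t _.
  rewrite -!fP //.
  rewrite !pi1Z ?pi2Z //; try exact: homogD.
  by rewrite pi1D // pi2D // p1 p2 !addr0.
exists (fun k => hpart k eta); split=> // g.
have [x [z [xz <-]]] := piS g; rewrite fE //; apply: eq_big_nat => k /andP[_ kn].
by rewrite -psit_psi ?psit_hpart //; exact: L.
Qed.

Lemma sum_psi_dil m (eta : nat -> Lam n R) g t :
  (forall k, (m <= k <= n)%N -> LamPi pi1 pi2 k (eta k)) ->
  \sum_(m <= k < n.+1) psi pi1 pi2 k (eta k) (dil t g) =
  (dil_poly n m (fun k => psi pi1 pi2 k (eta k) g)).[t].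
Proof.
move=> L; rewrite horner_dil_poly; apply: eq_big_nat => k mkn.
by rewrite psi_dil //; exact: L.
Qed.

Lemma psi_inj k eta xi : (k <= n)%N -> LamPi pi1 pi2 k eta -> LamPi pi1 pi2 k xi ->
  psi pi1 pi2 k eta =1 psi pi1 pi2 k xi -> eta = xi.
Proof.
move=> kn Le Lx e; apply: (homog_eq Le.1 Lx.1) => T Tk.
apply/eqP; rewrite -subr_eq0 -mulN1r addrC -LamZE -LamDE; apply/eqP.
apply: (psit_nondeg kn) => // x z xz.
by rewrite psitP !psit_psi // e mulN1r addNr.
Qed.

End Morphism.

(** * Degree bound and assembly of the theorem *)

Lemma span_closed (R : realType) (V : vectType R) (P : V -> Prop) (X : seq V) : P 0 ->
  (forall a u v, P u -> P v -> P (a *: u + v)) ->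
  (forall u, u \in X -> P u) -> forall u, u \in <<X>>%VS -> P u.
Proof.
move=> P0 PC PX u uX; rewrite (coord_span (X := in_tuple X) uX).
have PZ a v : P v -> P (a *: v) by move=> Pv; rewrite -[_ *: _]addr0; exact: PC.
elim/big_ind: _ => // [v w Pv Pw|i _]; first by rewrite -[v]scale1r; exact: PC.
by apply/PZ/PX/mem_nth; rewrite /=.
Qed.
(** With a basis of [V1] as generators the degree bound is the rank, and [br_span] places every [z]
    in their [in_span2]. *)
Lemma h_affine_dil (R : realType) (V1 V2 : vectType R) (br : V1 -> V1 -> V2)
  (br_linl : forall (a : R) (x y w : V1), br (a *: x + y) w = a *: br x w + br y w)
  (br_skew : forall x y : V1, br x y = - br y x)
  (br_span : forall w : V2, exists s : seq (V1 * V1),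
      w \in <<[seq br p.1 p.2 | p <- s]>>%VS) (f : V1 * V2 -> R) :
  h_affine br f -> forall g : V1 * V2, exists q : {poly R},
    (size q <= (\dim {: V1}%VS).+1)%N /\ forall t : R, f (dil t g) = q.[t].
Proof.
move=> fA [x z]; have sx y : in_span (vbasis {: V1}%VS) y.
  apply: (@span_closed _ _ (in_span (vbasis {: V1}%VS)) (vbasis {: V1}%VS)).
  - exact: in_span0.
  - by move=> a u v; exact: in_spanP.
  - exact: in_span_mem.
  - by rewrite (span_basis (vbasisP _)) memvf.
have sz : in_span2 br (vbasis {: V1}%VS) z.
  have [s zs] := br_span z; move: z zs; apply: span_closed.
  - exact: in_span20.
  - by move=> a u v; exact: in_span2P.
  - by move=> _ /mapP[p _ ->]; exact: in_span2_br.
have [q [sq qE]] := split_affine_dil br_linl br_skew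
  (h_affine_split br_linl br_skew fA) (sx x) sz.
by exists q; rewrite size_tuple in sq.
Qed.

Theorem theorem1p2 (R : realType) (V1 V2 : vectType R) (br : V1 -> V1 -> V2)
  (br_linl : forall (a : R) (x y w : V1), br (a *: x + y) w = a *: br x w + br y w)
  (br_skew : forall x y : V1, br x y = - br y x)
  (br_span : forall w : V2, exists s : seq (V1 * V1),
      w \in <<[seq br p.1 p.2 | p <- s]>>%VS)
  (V2_nz : exists w : V2, w != 0) :
  let r := \dim {: V1}%VS in
  (* (a) *)
  (forall f : V1 * V2 -> R, h_affine br f ->
     forall g : V1 * V2, exists q : {poly R},
       (size q <= r.+1)%N /\ forall t : R, 0 < t -> f (dil t g) = q.[t])
  /\
  (* (b) *)
  (forall (n : nat) (pi1 : Lam n R -> V1) (pi2 : Lam n R -> V2),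
     (r <= n)%N -> carnot_morphism br pi1 pi2 -> carnot_surj pi1 pi2 ->
     (* psi_eta exists and is unique *)
     (forall (k : nat) (eta : Lam n R), (k <= n)%N -> LamPi pi1 pi2 k eta ->
        (forall th om, inFn th om -> psit k eta th om = psi pi1 pi2 k eta (pi1 th, pi2 om))
        /\ (forall ps : V1 * V2 -> R,
              (forall th om, inFn th om -> psit k eta th om = ps (pi1 th, pi2 om)) ->
              forall g, ps g = psi pi1 pi2 k eta g))
     /\
     (* eta |-> psi_eta is linear *)
     (forall (k : nat) (a : R) (eta eta' : Lam n R) (g : V1 * V2),
        psi pi1 pi2 k (a *: eta + eta') g
        = a * psi pi1 pi2 k eta g + psi pi1 pi2 k eta' g)
     /\
     (* characterization of A_h(G) *)
     (forall f : V1 * V2 -> R,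
        h_affine br f <->
        exists eta : nat -> Lam n R,
          (forall k, (n - r <= k <= n)%N -> LamPi pi1 pi2 k (eta k)) /\
          forall g, f g = \sum_(n - r <= k < n.+1) psi pi1 pi2 k (eta k) g)
     /\
     (* uniqueness and identification psi_{eta_k} = f_{n-k} *)
     (forall (f : V1 * V2 -> R) (eta : nat -> Lam n R),
        (forall k, (n - r <= k <= n)%N -> LamPi pi1 pi2 k (eta k)) ->
        (forall g, f g = \sum_(n - r <= k < n.+1) psi pi1 pi2 k (eta k) g) ->
        (forall k, (n - r <= k <= n)%N ->
           forall g, psi pi1 pi2 k (eta k) g = fcoef f (n - k) g)
        /\ (forall eta' : nat -> Lam n R,
              (forall k, (n - r <= k <= n)%N -> LamPi pi1 pi2 k (eta' k)) ->
              (forall g, f g = \sum_(n - r <= k < n.+1) psi pi1 pi2 k (eta' k) g) ->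
              forall k, (n - r <= k <= n)%N -> eta' k = eta k))).
Proof.
move=> r; have fdil := h_affine_dil br_linl br_skew br_span.
split=> [f fA g|n pi1 pi2 rn piM piS].
  by have [q [sq qE]] := fdil f fA g; exists q; split=> // t _.
split=> [k eta _ L|].
  by split; [exact: (psit_psi piM L) | move=> ps; exact: (psi_unique piM piS L)].
split; first by move=> k a eta eta' g; exact: psi_linear.
split=> [f|].
  split=> [fA|[eta [L fE]]]; last first.
    rewrite (funext fE); apply: h_affine_sum => k.
    rewrite mem_index_iota ltnS => kn.
    exact: (psi_h_affine br_linl br_skew piM piS (L k kn)).
  have [eta [L fE]] := h_affine_forms br_linl br_skew piM piS fA.
  exists eta; split=> [k /andP[_ kn]|g]; first exact: L.
  rewrite fE (big_cat_nat (n := n - r)) ?leq_subr //=; last by lia.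
  rewrite big1_seq ?add0r // => k /andP[_]; rewrite mem_index_iota => /andP[_ kr].
  have kn : (k <= n)%N by lia.
  (* Here [k < n - r]: the value of [psi] is the coefficient of exponent [n - k > r] in the dilation
     polynomial, which the degree bound makes zero. *)
  have [q [sq qE]] := fdil f fA g.
  rewrite -(@coef_dil_poly R n 0 (fun k => psi pi1 pi2 k (eta k) g)) //=.
  have -> : dil_poly n 0 (fun k => psi pi1 pi2 k (eta k) g) = q.
    by apply: poly_eq_pos => t _; rewrite -qE fE (sum_psi_dil piM piS).
  by move/leq_sizeP: sq; apply; rewrite -/r; lia.
have coefE f eta k g : (forall k, (n - r <= k <= n)%N -> LamPi pi1 pi2 k (eta k)) ->
    (forall g, f g = \sum_(n - r <= k < n.+1) psi pi1 pi2 k (eta k) g) ->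
    (n - r <= k <= n)%N -> psi pi1 pi2 k (eta k) g = fcoef f (n - k) g.
  move=> L fE kn; rewrite /fcoef.
  (* The dilation polynomial represents [f (dil t g)] for every real [t], so the derivative at 0 is
     a formal one and equals [(n - k)!] times the coefficient. *)
  have -> : (fun t : R => (f (dil t g) : R^o)) = (fun t : R =>
      ((dil_poly n (n - r) (fun k => psi pi1 pi2 k (eta k) g)).[t] : R^o)).
    by apply/funext => t; rewrite fE (sum_psi_dil piM piS).
  rewrite derive1n_horner horner_coef0 coef_derivn addn0 coef_dil_poly // ffactnn.
  by rewrite -[X in X / _]mulr_natr mulfK // pnatr_eq0 -lt0n fact_gt0.
move=> f eta L fE; split=> [k kn g|eta' L' fE' k kn]; first exact: coefE.
apply: (psi_inj piM _ (L' k kn) (L k kn)) => [|g]; first by case/andP: kn.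
by rewrite (coefE f eta') // (coefE f eta).
Qed.
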